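(* Let $n\ge3$ and $r\ge1$ be integers, put $m=r+1$, and let $p$ be a prime with $p>n$ and $m\mid p-1$. Then $$D_n(r)=m^{1-n}\sum_{M\in\mathcal M_{\max}}\frac{\operatorname{mult}(M)}{\eta(M)}\,\Theta_0(M)\quad\text{in }\mathbb F_p .$$ Moreover, the local evaluation of $\Theta_0(M)$ (described in the context) has the same asymptotic cost as the local evaluation of $\Theta(M)$ (described in the context), namely $O(n^2)$ field operations per multiset $M$.
   Context: $D_n(r)$ is the number of $n\times n$ nonnegative integer matrices with all diagonal entries $0$ and all row sums and column sums equal to $r$. In an identity in $\mathbb F_p$ integers are reduced modulo $p$. $\Omega=\{a\in\mathbb F_p:a^m=1\}$ (which has $m$ elements); $\mathcal M$ is the set of multisets of size $n$ from $\Omega$; $\mu_a$ is the multiplicity of $a$ in $M$; $\operatorname{mult}(M)=n!/\prod_a\mu_a!$; $q(M)=\max_a\mu_a$; $\eta(M)=\#\{a:\mu_a=q(M)\}$; $\mathcal M_{\max}=\{M\in\mathcal M:\mu_1=q(M)\ge2\}$. $h_j$ is the complete homogeneous symmetric polynomial of degree $j$ in $n$ variables and $h_j(M)$ its value on the entries of $M$. Further $$\Theta(M)=\Big(\prod_aa^{\mu_a}\Big)h_r(M)^n,\qquad \Theta_0(M)=\Big(\prod_a a^{\mu_a}\Big)\prod_a\bigl(h_r(M)-a\,h_{r-1}(M)\bigr)^{\mu_a}.$$ Local evaluations (cost is counted in additions, multiplications and divisions in $\mathbb F_p$). For each $a$ with $\mu_a\ge2$, let $M'$ be $M$ with all copies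 of $a$ removed, $C_a=\frac{(-1)^{\mu_a}m}{a}\prod_{b\in M'}(1-b/a)^{-1}$, and let $f_{a,j}=[s^j]F_a(s)$ for $0\le j\le\mu_a-2$, where $F_a(s)=e^{-rs}\frac{T(s)^{\mu_a}}{T(ms)}\prod_{b\in M'}\frac{1-b/a}{1-(b/a)e^s}$, $T(s)=s/(e^s-1)$ (truncated series, coefficients reduced modulo $p$). The coefficients $f_{a,j}$ are computed from $\ell_{a,j}=[s^j]\log F_a(s)$ by $f_{a,0}=1$, $f_{a,j}=\frac1j\sum_{i=1}^ji\,\ell_{a,i}f_{a,j-i}$; the $\ell_{a,j}$ and $C_a$ are obtained by summing and multiplying entries of precomputed tables (depending only on $m,p,n$) indexed by root ratios $b/a$, multiplicities and $j\le n-2$. The local evaluation of $\Theta(M)$ computes these quantities and then $h_r(M)=\sum_{a:\mu_a\ge2}C_af_{a,\mu_a-2}$ and $\Theta(M)$, at a cost of $O(n^2)$. The local evaluation of $\Theta_0(M)$ computes the same $C_a$, $f_{a,j}$ and $h_r(M)$, together with $$h_{r-1}(M)=\sum_{a:\,\mu_a\ge2}\frac{C_a}{a}\sum_{j=0}^{\mu_a-2}\frac{f_{a,j}}{(\mu_a-2-j)!},$$ and then forms $\Theta_0(M)$. *)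

(* Defs.v *)
From mathcomp Require Import all_boot all_order all_algebra.
From mathcomp Require Import mpoly.

Set Implicit Arguments.
Unset Strict Implicit.
Unset Printing Implicit Defensive.

Import GRing.Theory.
Local Open Scope ring_scope.

(* Row sums equal to r force every entry to be at most r, so the matrices
   counted by D_n(r) all have entries in 'I_r.+1 = {0, ..., r}. *)
Definition Dcount (n r : nat) : nat :=
  #|[set A : 'M['I_r.+1]_n |
     [&& [forall i, (A i i : nat) == 0%N],
         [forall i, (\sum_j (A i j : nat))%N == r]
       & [forall j, (\sum_i (A i j : nat))%N == r]]]|.

Definition hsym (R : comNzRingType) (n j : nat) : {mpoly R[n]} :=
  \sum_(u : 'X_{1..n < j.+1} | mdeg u == j) 'X_[u].

(* Power series modulo s^N, represented by polynomials in s = 'X of size at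
   most N. They are used with N = n - 1, i.e. for the coefficients of s^j with
   j <= n - 2. Since n < p, the factorials and integers inverted below are
   nonzero in F_p, so these are the reductions modulo p of the usual series. *)
Section TruncatedSeries.

Variables (F : fieldType) (N : nat).

(* e^(c s) *)
Definition expS (c : F) : {poly F} := \poly_(j < N) (c ^+ j / j`!%:R).

(* 1 / f, for f with nonzero constant term f0:
   1 / f = f0^-1 * sum_k (1 - f / f0)^k *)
Definition invS (f : {poly F}) : {poly F} :=
  take_poly N ((f`_0)^-1 *: \sum_(k < N) (1 - (f`_0)^-1 *: f) ^+ k).

(* log f, for f with constant term 1 *)
Definition logS (f : {poly F}) : {poly F} :=
  take_poly N (\sum_(1 <= k < N) ((-1) ^+ k.-1 / k%:R) *: (f - 1) ^+ k).

(* T(s) = s / (e^s - 1), where (e^s - 1) / s = sum_j s^j / (j + 1)! *)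
Definition toddS : {poly F} := invS (\poly_(j < N) (j.+1`!%:R)^-1).

(* T(c s) *)
Definition toddS_at (c : F) : {poly F} := toddS \Po (c *: 'X).

(* (1 - c) / (1 - c e^s), for c <> 1 *)
Definition ratioS (c : F) : {poly F} :=
  take_poly N ((1 - c) *: invS (1 - c *: expS 1)).

End TruncatedSeries.

(* Values together with the number of field operations spent on them.
   Only cadd, csub, cmul and cdiv have a cost; table lookups, integer constants
   modulo p and the control flow (which is governed by the multiplicities) are
   free. *)
Definition counted (A : Type) : Type := (A * nat)%type.

Definition value (A : Type) (x : counted A) : A := x.1.
Definition cost (A : Type) (x : counted A) : nat := x.2.

Definition cret (A : Type) (x : A) : counted A := (x, 0%N).
Definition cbind (A B : Type) (x : counted A) (k : A -> counted B) :
  counted B := ((k x.1).1, (x.2 + (k x.1).2)%N).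

Notation "'let!' x ':=' c 'in' k" := (cbind c (fun x => k))
  (at level 200, x name, c at level 100, k at level 200).

Fixpoint cmap (A B : Type) (f : A -> counted B) (s : seq A) :
    counted (seq B) :=
  if s is x :: s' then
    let! y := f x in let! ys := cmap f s' in cret (y :: ys)
  else cret [::].

Section Arithmetic.

Variable F : fieldType.

Definition cadd (x y : F) : counted F := (x + y, 1%N).
Definition csub (x y : F) : counted F := (x - y, 1%N).
Definition cmul (x y : F) : counted F := (x * y, 1%N).
Definition cdiv (x y : F) : counted F := (x / y, 1%N).

Fixpoint csum (s : seq F) : counted F :=
  if s is x :: s' then let! y := csum s' in cadd x y else cret 0.

Fixpoint cprod (s : seq F) : counted F :=
  if s is x :: s' then let! y := cprod s' in cmul x y else cret 1.

Definition cpow (x : F) (k : nat) : counted F := cprod (nseq k x).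

(* The coefficients f_0, ..., f_J of a series with constant term 1 from the
   coefficients l_j of its logarithm: f_j = (1/j) sum_(1 <= i <= j) i l_i f_(j-i)
   (the i%:R and j%:R are constants). *)
Fixpoint cexp_coefs (l : seq F) (J : nat) : counted (seq F) :=
  if J is J'.+1 then
    let! f := cexp_coefs l J' in
    let! t := cmap (fun i => let! u := cmul i%:R l`_i in cmul u f`_(J - i))
                   (iota 1 J) in
    let! u := csum t in
    let! fJ := cdiv u J%:R in
    cret (rcons f fJ)
  else cret [:: 1].

End Arithmetic.

(* F stands for F_p, and m = r + 1 is written r.+1. *)
Section Multisets.

Variables (F : finFieldType) (n r : nat).

Definition Omega : {set F} := [set a | a ^+ r.+1 == 1].

(* A multiset of elements of F is given by its multiplicities a |-> mu_a, each
   of which is at most the size n of the multiset. *)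

Implicit Types (M : {ffun F -> 'I_n.+1}) (a b c : F).

Definition Msets : {set {ffun F -> 'I_n.+1}} :=
  [set M : {ffun F -> 'I_n.+1} |
     [forall a, (a \notin Omega) ==> ((M a : nat) == 0%N)] &&
     ((\sum_(a in Omega) (M a : nat))%N == n)].

Definition qmax M : nat := (\max_(a in Omega) (M a : nat))%N.

Definition eta M : nat := #|[set a in Omega | (M a : nat) == qmax M]|.

Definition multM M : nat := (n`! %/ \prod_(a in Omega) (M a)`!)%N.

Definition Mmax : {set {ffun F -> 'I_n.+1}} :=
  [set M in Msets | ((M 1 : nat) == qmax M) && (2 <= qmax M)%N].

Definition entries M : seq F := flatten [seq nseq (M a) a | a <- enum Omega].

Definition hM (j : nat) M : F :=
  (hsym F n j).@[fun i : 'I_n => (entries M)`_i].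

Definition Theta M : F := (\prod_(a in Omega) a ^+ M a) * hM r M ^+ n.

Definition Theta0 M : F :=
  (\prod_(a in Omega) a ^+ M a) *
  \prod_(a in Omega) (hM r M - a * hM r.-1 M) ^+ M a.

(* Local data at a: the products over M' run over the b <> a, raised to their
   multiplicities. *)

Definition Clocal M a : F :=
  (-1) ^+ M a * r.+1%:R / a *
  \prod_(b in Omega | b != a) ((1 - b / a)^-1) ^+ M b.

Definition Flocal M a : {poly F} :=
  take_poly n.-1
    (expS n.-1 (- r%:R) * toddS F n.-1 ^+ M a *
     invS n.-1 (toddS_at n.-1 r.+1%:R) *
     \prod_(b in Omega | b != a) ratioS n.-1 (b / a) ^+ M b).

Definition flocal M a (j : nat) : F := (Flocal M a)`_j.

Definition llocal M a (j : nat) : F := (logS n.-1 (Flocal M a))`_j.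

(* The precomputed tables. They are indexed by a root ratio c, a multiplicity k
   and an exponent j <= n - 2, and do not involve the multiset. Taking logarithms
   in the product defining F_a gives
   l_(a,j) = tab_log1 mu_a j + sum_(b <> a) tab_log (b / a) mu_b j. *)

Definition tab_C1 (k : nat) : F := (-1) ^+ k * r.+1%:R.

Definition tab_C (c : F) (k : nat) : F := ((1 - c)^-1) ^+ k.

Definition tab_log1 (k j : nat) : F :=
  (logS n.-1 (take_poly n.-1
     (expS n.-1 (- r%:R) * toddS F n.-1 ^+ k *
      invS n.-1 (toddS_at n.-1 r.+1%:R))))`_j.

Definition tab_log (c : F) (k j : nat) : F :=
  (logS n.-1 (take_poly n.-1 (ratioS n.-1 c ^+ k)))`_j.

Definition tab_fact (j : nat) : F := j`!%:R.

Definition supp M : seq F := [seq a <- enum Omega | (0 < M a)%N].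

Definition poles M : seq F := [seq a <- enum Omega | (2 <= M a)%N].

(* The lists (l_(a,j)) and (f_(a,j)) for 0 <= j <= mu_a - 2, and C_a. *)
Definition eval_local M a : counted (seq F * seq F * F) :=
  let! cs := cmap (fun b => let! c := cdiv b a in cret (c, M b : nat))
                  [seq b <- supp M | b != a] in
  let! u := cdiv (tab_C1 (M a)) a in
  let! v := cprod [seq tab_C x.1 x.2 | x <- cs] in
  let! C := cmul u v in
  let! l := cmap (fun j => csum (tab_log1 (M a) j ::
                                 [seq tab_log x.1 x.2 j | x <- cs]))
                 (iota 0 (M a).-1) in
  let! f := cexp_coefs l (M a - 2) in
  cret (l, f, C).

(* The list of the (a, f, C) for the a with mu_a >= 2, where f = (f_(a,j)). *)
Definition eval_data M : counted (seq (F * seq F * F)) :=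
  cmap (fun a => let! d := eval_local M a in cret (a, d.1.2, d.2)) (poles M).

(* h_r(M) = sum_a C_a f_(a,mu_a-2) *)
Definition eval_hr M (data : seq (F * seq F * F)) : counted F :=
  let! t := cmap (fun d => let: (a, f, C) := d in cmul C f`_(M a - 2)) data in
  csum t.

(* h_(r-1)(M) = sum_a C_a / a * sum_(0 <= j <= mu_a - 2) f_(a,j) / (mu_a-2-j)! *)
Definition eval_hr1 M (data : seq (F * seq F * F)) : counted F :=
  let! t := cmap (fun d => let: (a, f, C) := d in
                  let! g := cmap (fun j => cdiv f`_j (tab_fact (M a - 2 - j)))
                                 (iota 0 (M a).-1) in
                  let! v := csum g in
                  let! u := cdiv C a in
                  cmul u v) data in
  csum t.

Definition eval_root_prod M : counted F :=
  let! t := cmap (fun a => cpow a (M a)) (supp M) in cprod t.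

(* The local evaluation of Theta(M), returning (h_r(M), Theta(M)). *)
Definition eval_Theta M : counted (F * F) :=
  let! data := eval_data M in
  let! hr := eval_hr M data in
  let! u := eval_root_prod M in
  let! v := cpow hr n in
  let! th := cmul u v in
  cret (hr, th).

(* The local evaluation of Theta_0(M), returning
   (h_r(M), h_(r-1)(M), Theta_0(M)). *)
Definition eval_Theta0 M : counted (F * F * F) :=
  let! data := eval_data M in
  let! hr := eval_hr M data in
  let! hr1 := eval_hr1 M data in
  let! u := eval_root_prod M in
  let! t := cmap (fun a => let! w := cmul a hr1 in
                           let! x := csub hr w in
                           cpow x (M a)) (supp M) in
  let! v := cprod t in
  let! th := cmul u v in
  cret (hr, hr1, th).

End Multisets.

(* Main.v *)
(* D_n(r) is the coefficient of (x_1 ... x_n)^r in the product over i of h_r of the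
   variables other than x_i, that is, of h_r(x) - x_i h_(r-1)(x). This polynomial
   has degree n r, so averaging x_1 ... x_n times it over Omega^n extracts exactly
   this coefficient; grouping the points of Omega^n by multiset gives a sum over
   all M. The summand is invariant under dilation by Omega, which moves a root of
   maximal multiplicity to 1.

   The local formulas express h_r(M) and h_(r-1)(M) as sums of residues of
   X^i (X^m - 1) dX / prod (X - x), with i = n - 2 and i = n - 3, computed in the
   parameter s given by X = a e^(-s) at each root a. The residue theorem is proved
   for truncated series, in the quotient of F[s] by s^N, when the characteristic
   exceeds the pole orders. The local formulas also show that the summand vanishes
   when no multiplicity exceeds 1, as there is then no pole left. *)

Require Import Defs.
From mathcomp Require Import all_boot all_order all_algebra.
From mathcomp Require Import cyclic finfield mpoly qpoly.
From mathcomp Require Import ring zify.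

Set Implicit Arguments.
Unset Strict Implicit.
Unset Printing Implicit Defensive.

Import GRing.Theory.
Local Open Scope ring_scope.

(** * Truncated power series *)

(** The parameter s is chosen because X^m - 1 becomes e^(-ms) - 1 at every root a, while each factor
    X - b, up to the scalar a, involves only the ratio b / a; this makes tables independent of the
    multiset possible. Passing from X^(n-2) to X^(n-3) merely multiplies the expansion at a by e^s /
    a, so h_(r-1)(M) reuses the coefficients f_(a,j) of h_r(M) at an extra cost linear in n. The
    exponent n - 3 is where n >= 3 enters. The delicate point is the invariance of residues under X
    = a e^(-s) in characteristic p, since writing a form as an exact differential divides by
    integers. Cancelling factors X - c on both sides of the residue theorem leaves only pure poles c
    / (X - a)^(k+1), hence a single vanishing coefficient, for which one divides by an integer at
    most n - 1. The factor m^(1-n) is m^(-n) from averaging times m for the m possible positions of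
    a most frequent root. *)

Local Notation tr N := (in_qpoly 'X^N).

Section Trunc.
Variable F : fieldType.
Implicit Types (f g : {poly F}) (N : nat) (c d : F).


Lemma val_tr N f : (0 < N)%N -> val (tr N f) = take_poly N f.
Proof. by move=> N0; rewrite /= mk_monic_Xn prednK // Pdiv.RingMonic.take_poly_rmodp. Qed.

(** Unlike [take_poly N], the map [in_qpoly 'X^N] is a ring morphism, so identities between series
    are proved in the quotient; this lemma carries them back to coefficients. *)
Lemma trP N f g : (0 < N)%N ->
  (tr N f = tr N g) <-> (forall j, (j < N)%N -> f`_j = g`_j).
Proof.
move=> N0; split=> [/(congr1 val)|fg].
  rewrite !val_tr // => e j jN.
  by move/polyP/(_ j): e; rewrite !coef_take_poly jN.
apply: val_inj; rewrite !val_tr //; apply/polyP => j.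
by rewrite !coef_take_poly; case: ifP => // /fg.
Qed.

Lemma tr_take N f : (0 < N)%N -> tr N (take_poly N f) = tr N f.
Proof. by move=> N0; apply/trP => // j jN; rewrite coef_take_poly jN. Qed.

Lemma tr_mono N' N f g : (0 < N' <= N)%N -> tr N f = tr N g -> tr N' f = tr N' g.
Proof.
case/andP=> N'0 le; move/(trP _ _ (leq_trans N'0 le)) => fg.
by apply/trP => // j jN; apply: fg; apply: leq_trans le.
Qed.

(** Multiplication by ['X] regains the order of precision that [tr_deriv] loses, so s d/ds is well
    defined modulo a fixed power of s. *)
Lemma trXM N f g : (0 < N)%N -> tr N f = tr N g -> tr N.+1 ('X * f) = tr N.+1 ('X * g).
Proof.
move=> N0 /(trP _ _ N0) fg; apply/trP => // -[|j] jN; rewrite !coefXM //=.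
exact: fg.
Qed.

Lemma tr_deriv N f g : (0 < N)%N -> tr N.+1 f = tr N.+1 g -> tr N f^`() = tr N g^`().
Proof.
move=> N0 /trP fg; apply/trP => // j jN; rewrite !coef_deriv fg //.
Qed.

Lemma coef_comp_scaleX c f j : (f \Po (c *: 'X))`_j = c ^+ j * f`_j.
Proof.
rewrite comp_polyE coef_sum.
under eq_bigr do rewrite coefZ exprZn coefZ coefXn.
have [lt|ge] := ltnP j (size f).
  rewrite (bigD1 (Ordinal lt)) //= eqxx mulr1 mulrC big1 ?addr0 // => i ne.
  by rewrite eq_sym -(inj_eq val_inj) /= in ne *; rewrite (negbTE ne) !mulr0.
rewrite [in RHS]nth_default // mulr0 big1 // => i _.
by rewrite gtn_eqF ?mulr0 // (leq_trans _ ge).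
Qed.

Lemma tr_comp_scaleX N c f g : (0 < N)%N ->
  tr N f = tr N g -> tr N (f \Po (c *: 'X)) = tr N (g \Po (c *: 'X)).
Proof.
move=> N0 /(trP _ _ N0) fg; apply/trP => // j jN.
by rewrite !coef_comp_scaleX fg.
Qed.

Lemma tr_expr0 N f : (0 < N)%N -> f`_0 = 0 -> tr N (f ^+ N) = 0.
Proof.
move=> N0 f0; rewrite -(rmorph0 (tr N)).
have -> : f = f %/ 'X * 'X.
  by apply/esym/divpK; rewrite -['X]subr0 -polyC0 dvdp_XsubCl rootE horner_coef0 f0.
rewrite exprMn; apply/trP => // j jN; by rewrite coefMXn jN coef0.
Qed.

Lemma coefM0 f g : (f * g)`_0 = f`_0 * g`_0.
Proof. by rewrite -!horner_coef0 hornerM. Qed.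

(** The sum in [invS] is geometric and telescopes to 1 - x^N with x = 1 - f / f_0; here x^N = 0
    because x has no constant term. *)
Lemma tr_invS N f : (0 < N)%N -> f`_0 != 0 -> tr N (invS N f) * tr N f = 1.
Proof.
move=> N0 f0; rewrite /invS tr_take //; set u := _^-1; set x : {poly F} := 1 - u *: f.
have uf : u *: f = 1 - x by rewrite /x opprB addrC subrK.
rewrite -rmorphM -scalerAl mulrC scalerAl uf -opprB mulNr -subrX1 opprB.
rewrite rmorphB rmorph1 /= tr_expr0 ?subr0 //.
by rewrite coefB coefZ coef1 mulVf ?subrr.
Qed.

Lemma tr_inv_uniq N f g h : tr N g * tr N f = 1 -> tr N h * tr N f = 1 ->
  tr N g = tr N h.
Proof. by move=> gf hf; rewrite -[LHS]mulr1 -hf mulrCA gf mulr1. Qed.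

(* The characteristic of F is 0 or larger than N. *)
Definition natr_unit N := forall k, (0 < k <= N)%N -> k%:R != 0 :> F.

Lemma natr_unit_le N' N : (N' <= N)%N -> natr_unit N -> natr_unit N'.
Proof. by move=> le H k /andP[k0 kN]; apply: H; rewrite k0 (leq_trans kN). Qed.

Lemma fact_neq0 N k : natr_unit N -> (k <= N)%N -> k`!%:R != 0 :> F.
Proof.
move=> H; elim: k => [|k IH] kN; first by rewrite oner_eq0.
by rewrite factS natrM mulf_neq0 ?IH ?H // ltnW.
Qed.

Lemma coef_expS N c j : (expS N c)`_j = if (j < N)%N then c ^+ j / j`!%:R else 0.
Proof. exact: coef_poly. Qed.

Lemma tr_expSD N c d : (0 < N)%N -> natr_unit N ->
  tr N (expS N (c + d)) = tr N (expS N c) * tr N (expS N d).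
Proof.
move=> N0 H; rewrite -rmorphM; apply/trP => // j jN.
rewrite coefM coef_expS jN addrC exprDn mulr_suml; apply: eq_bigr => -[i /=].
rewrite ltnS => ij _.
rewrite !coef_expS (leq_ltn_trans ij) // (leq_ltn_trans (leq_subr _ _)) //.
have fi := fact_neq0 H (leq_trans ij (ltnW jN)).
have fji := fact_neq0 H (leq_trans (leq_subr i j) (ltnW jN)).
have := fact_neq0 H (ltnW jN).
rewrite -(bin_fact ij) !natrM !mulf_eq0 !negb_or => /and3P[b0 _ _].
by rewrite -mulr_natr; field; rewrite b0 fi fji.
Qed.

Lemma expS0 N : (0 < N)%N -> expS N (0 : F) = 1.
Proof.
move=> N0; apply/polyP => j; rewrite coef_expS coef1 expr0n.
by case: j => [|j]; rewrite ?N0 ?divr1 //= mul0r if_same.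
Qed.

Lemma tr_expSN N c : (0 < N)%N -> natr_unit N ->
  tr N (expS N c) * tr N (expS N (- c)) = 1.
Proof. by move=> N0 H; rewrite -tr_expSD // subrr expS0 // rmorph1. Qed.

Lemma tr_expSX N c k : (0 < N)%N -> natr_unit N ->
  tr N (expS N c) ^+ k = tr N (expS N (c *+ k)).
Proof.
move=> N0 H; elim: k => [|k IH]; first by rewrite expS0 // rmorph1.
by rewrite exprS IH mulrS tr_expSD.
Qed.

Lemma expS_deriv N c : natr_unit N -> (expS N.+1 c)^`() = c *: expS N c.
Proof.
move=> H; apply/polyP => j; rewrite coef_deriv coefZ !coef_expS ltnS.
case: ltnP => jN; last by rewrite mul0rn mulr0.
have jf := fact_neq0 H (ltnW jN); have j1 : j.+1%:R != 0 :> F by apply: H; lia.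
rewrite factS natrM exprS -[LHS]mulr_natr.
by move: (j.+1%:R) j1 (j`!%:R) jf => x x0 y y0; field; rewrite x0 y0.
Qed.

(** The series (e^s - 1) / s, whose reciprocal is T(s). *)
Definition bernS N : {poly F} := \poly_(j < N) (j.+1`!%:R)^-1.

Lemma expS_bernS N c : expS N.+1 c - 1 = c *: ('X * (bernS N \Po (c *: 'X))).
Proof.
apply/polyP => j; rewrite coefZ coefB coef1 coef_expS coefXM coef_comp_scaleX.
rewrite coef_poly; case: j => [|j] /=; first by rewrite divr1 subrr mulr0.
by rewrite subr0 ltnS; case: ifP => _; rewrite ?mulr0 // exprS mulrA.
Qed.

Lemma tr_toddS N : (0 < N)%N -> tr N (toddS F N) * tr N (bernS N) = 1.
Proof.
by move=> N0; apply: tr_invS; rewrite // coef_poly N0 invr1 oner_eq0.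
Qed.

Lemma tr_todd_atS N c : (0 < N)%N ->
  tr N (invS N (toddS_at N c)) = tr N (bernS N \Po (c *: 'X)).
Proof.
move=> N0; have e : tr N (toddS_at N c) * tr N (bernS N \Po (c *: 'X)) = 1.
  rewrite -rmorphM -comp_polyM.
  have := tr_toddS N0; rewrite -rmorphM -(rmorph1 (tr N)).
  by move/(tr_comp_scaleX c N0) => /= ->; rewrite comp_polyC.
apply: (@tr_inv_uniq _ (toddS_at N c)); last by rewrite mulrC.
apply: tr_invS => //; apply/eqP => z.
move/(congr1 val): e; rewrite -rmorphM val_tr //= => /polyP/(_ 0%N).
by rewrite coef_take_poly N0 coefM0 z mul0r coef1 => /esym/eqP; rewrite oner_eq0.
Qed.

Lemma tr_ratioS N c : (0 < N)%N -> c != 1 ->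
  tr N (ratioS N c) * tr N (1 - c *: expS N 1) = (1 - c)%:A.
Proof.
move=> N0 c1; rewrite /ratioS tr_take // linearZ /= -scalerAl tr_invS //.
rewrite coefB coefZ coef1 coef_expS N0 expr0 divr1 mulr1 subr_eq0 eq_sym.
exact: c1.
Qed.

(** Residues are computed at precision n, whereas the tables and [Flocal] live at precision n - 1;
    this lemma and the next two reconcile them. *)
Lemma tr_mono_expS N' N c : (0 < N' <= N)%N -> tr N' (expS N c) = tr N' (expS N' c).
Proof.
case/andP=> N'0 le; apply/trP => // j jN.
by rewrite !coef_expS jN (leq_trans jN).
Qed.

Lemma tr_mono_toddS N' N : (0 < N' <= N)%N ->
  tr N' (toddS F N) = tr N' (toddS F N').
Proof.
move=> /[dup] le /andP[N'0 le']; apply: (@tr_inv_uniq _ (bernS N')); last exact: tr_toddS.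
have -> : tr N' (bernS N') = tr N' (bernS N).
  by apply/trP => // j jN; rewrite !coef_poly jN (leq_trans jN).
have := tr_toddS (leq_trans N'0 le').
rewrite -[X in _ = X -> _](rmorph1 (tr N)) -rmorphM /= => /(tr_mono le).
by rewrite rmorphM rmorph1.
Qed.

Lemma tr_mono_ratioS N' N c : (0 < N' <= N)%N -> c != 1 ->
  tr N' (ratioS N c) = tr N' (ratioS N' c).
Proof.
move=> /[dup] le /andP[N'0 le'] c1.
have c1' : 1 - c != 0 by rewrite subr_eq0 eq_sym.
apply: (@tr_inv_uniq _ ((1 - c)^-1 *: (1 - c *: expS N' 1))).
  have := tr_ratioS (leq_trans N'0 le') c1.
  have <- : tr N (1 - c)%:A = (1 - c)%:A by rewrite linearZ rmorph1.
  rewrite -rmorphM /= => /(tr_mono le).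
  have e1 : tr N' (1 - c *: expS N 1) = tr N' (1 - c *: expS N' 1).
    by rewrite !linearB !linearZ /= tr_mono_expS.
  have e2 : tr N' (1 - c)%:A = (1 - c)%:A by rewrite linearZ /= rmorph1.
  rewrite rmorphM /= e1 e2 => e; rewrite [X in _ * X]linearZ /=.
  by rewrite -scalerAr e scalerA mulVf // scale1r.
by rewrite linearZ /= -scalerAr tr_ratioS // scalerA mulVf // scale1r.
Qed.

(* (1 - e^(-s))^(-k) d(e^(-s)) has residue 0 at s = 0: with u = e^s T(s) one has
   s u' = u (1 - T), hence e^(-s) u^k = V - s V' / (k - 1) for V = u^(k-1). *)
Lemma coef_expS_toddS_pow N k : natr_unit N -> (1 < k <= N)%N ->
  (expS N (-1) * (expS N 1 * toddS F N) ^+ k)`_k.-1 = 0.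
Proof.
case: k N => [|[|k]] [|[|N]] // H kN.
set E := expS _ 1; set T := toddS F _; set B := bernS N.+2.
have TB : tr N.+2 T * tr N.+2 B = 1 by apply: tr_toddS.
have XB : expS N.+3 1 - 1 = 'X * B.
  by rewrite (expS_bernS N.+2 1) !scale1r comp_polyXr.
have qXB : tr N.+2 'X * tr N.+2 B = tr N.+2 E - 1.
  by rewrite -rmorphM -XB rmorphB rmorph1 /= tr_mono_expS ?leqnSn.
have dB : B + 'X * B^`() = E.
  move/(congr1 deriv): XB; rewrite derivB derivM derivX mul1r expS_deriv //.
  by rewrite scale1r -polyC1 derivC subr0.
have XE' : tr N.+2 ('X * E^`()) = tr N.+2 'X * tr N.+2 E.
  rewrite -rmorphM /E expS_deriv; last exact: natr_unit_le H.
  by rewrite scale1r; apply: trXM; rewrite // tr_mono_expS ?leqnSn.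
have XTB' : tr N.+2 ('X * T^`()) * tr N.+2 B + tr N.+2 T * tr N.+2 ('X * B^`()) = 0.
  have : tr N.+2 (T * B) = tr N.+2 1 by rewrite rmorphM rmorph1.
  move/(tr_deriv (ltn0Sn _))/(trXM (ltn0Sn _)).
  rewrite -polyC1 derivC mulr0 rmorph0 derivM => <-.
  by rewrite -!rmorphM -rmorphD; congr (tr N.+2 _); ring.
(* The Riccati equation s T' = T - e^s T^2, from (T B)' = 0 and s B' = e^s - B. *)
have XT' : tr N.+2 ('X * T^`()) = tr N.+2 T - tr N.+2 E * tr N.+2 T ^+ 2.
  have dBq : tr N.+2 ('X * B^`()) = tr N.+2 E - tr N.+2 B.
    by rewrite -dB rmorphD addrAC subrr add0r.
  rewrite -[LHS]mulr1 -TB.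
  transitivity ((tr N.+2 ('X * T^`()) * tr N.+2 B) * tr N.+2 T); first by ring.
  rewrite -[X in X * _](addrK (tr N.+2 T * tr N.+2 ('X * B^`()))) XTB' sub0r dBq.
  transitivity (tr N.+2 T * (tr N.+2 T * tr N.+2 B) - tr N.+2 E * tr N.+2 T ^+ 2).
    by ring.
  by rewrite TB mulr1.
set u : {poly F} := E * T.
have Xu' : tr N.+2 ('X * u^`()) = tr N.+2 u * (1 - tr N.+2 T).
  have -> : 'X * u^`() = T * ('X * E^`()) + E * ('X * T^`()) by rewrite derivM; ring.
  rewrite rmorphD [X in X + _]rmorphM [X in _ + X]rmorphM /= XE' XT' /u rmorphM /=.
  have -> : tr N.+2 'X = tr N.+2 E * tr N.+2 T - tr N.+2 T.
    by rewrite -[LHS]mulr1 -TB mulrCA qXB; ring.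
  ring.
set V : {poly F} := u ^+ k.+1.
have XV' : tr N.+2 ('X * V^`()) = k.+1%:R * (tr N.+2 V * (1 - tr N.+2 T)).
  have -> : 'X * V^`() = k.+1%:R * (u ^+ k * ('X * u^`())).
    by rewrite deriv_exp -[X in _ * X]mulr_natl /=; ring.
  rewrite rmorphM [X in _ * X]rmorphM /= Xu' rmorph_nat /V !rmorphXn /=.
  by rewrite (exprSr (tr N.+2 u)) !mulrA.
have e : tr N.+2 (k.+1%:R * (expS N.+2 (-1) * u ^+ k.+2)) =
         tr N.+2 (k.+1%:R * V - 'X * V^`()).
  have -> : expS N.+2 (-1) * u ^+ k.+2 = (E * expS N.+2 (-1)) * (T * V).
    by rewrite exprS -/V /u -!mulrA mulrCA.
  rewrite rmorphB /= XV'.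
  have : tr N.+2 E * tr N.+2 (expS N.+2 (-1)) = 1 by apply: tr_expSN.
  rewrite -rmorphM /= => EE.
  rewrite rmorphM [X in _ * X]rmorphM /= EE !rmorphM /= rmorph_nat.
  by rewrite mul1r -mulrBr; congr (_ * _); rewrite mulrBr mulr1 opprB addrC subrK mulrC.
have k1 : k.+1%:R != 0 :> F by apply: H; lia.
(* After the case analysis, [k.+1] is the pole order minus one. At this exponent the two terms of (k
   + 1) V - s V' cancel. *)
move/trP/(_ k.+1): e => /(_ isT kN).
rewrite !mulr_natl coefB !coefMn coefXM coef_deriv /= subrr => /eqP.
by rewrite -mulr_natr mulf_eq0 (negbTE k1) orbF => /eqP.
Qed.

End Trunc.

(** * Logarithms of truncated series *)

Section Log.
Variables (F : fieldType) (N : nat).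
Hypotheses (N_gt0 : (0 < N)%N) (charF : natr_unit F N).
Implicit Types f g : {poly F}.

Lemma logS_coef0 f : f`_0 = 1 -> (logS N.+1 f)`_0 = 0.
Proof.
move=> f0; rewrite /logS coef_take_poly /= coef_sum big_nat big1 // => k /andP[k0 _].
by rewrite coefZ -horner_coef0 hornerE !hornerE horner_coef0 f0 subrr expr0n gtn_eqF ?mulr0.
Qed.

(** The termwise derivative of the logarithm is f' times the geometric sum of the (1 - f)^k, which
    telescopes as for [invS]. Differentiation costs one order, hence [N.+1] against [N]. *)
Lemma logS_deriv f : f`_0 = 1 -> tr N ((logS N.+1 f)^`() * f) = tr N f^`().
Proof.
move=> f0; set g : {poly F} := \sum_(1 <= k < N.+1) ((-1) ^+ k.-1 / k%:R) *: (f - 1) ^+ k.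
have -> : tr N ((logS N.+1 f)^`() * f) = tr N (g^`() * f).
  rewrite !rmorphM /=; congr (_ * _); apply: tr_deriv => //; exact: tr_take.
have -> : g^`() = f^`() * \sum_(k < N) (1 - f) ^+ k.
  rewrite /g raddf_sum big_add1 /= mulr_sumr big_mkord; apply: eq_bigr => -[k kN] _ /=.
  have k1 : k.+1%:R != 0 :> F by apply: charF.
  rewrite derivZ deriv_exp derivB -polyC1 derivC subr0 polyC1 /=.
  rewrite -[1 - f]opprB [in RHS]exprNn -scaler_nat scalerA divfK //.
  rewrite -(signr_odd F) -[in RHS]signr_odd.
  by case: (odd k); rewrite ?expr0 ?expr1 ?scale1r ?mul1r ?scaleN1r ?mulN1r ?mulrN.
have -> : f^`() * (\sum_(k < N) (1 - f) ^+ k) * f = (1 - (1 - f) ^+ N) * f^`().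
  rewrite -[1 - _ ^+ N]opprB subrX1 -mulNr opprB opprD opprK addrA subrr add0r.
  by ring.
rewrite rmorphM rmorphB rmorph1 /= tr_expr0 //.
  by rewrite subr0 mul1r.
by rewrite coefB coef1 f0 subrr.
Qed.

(** As 1, ..., N are invertible, a series is determined modulo s^(N+1) by its constant term and its
    derivative. The logarithm is thus the only solution of g' f = f' with g(0) = 0, and its
    functional equation follows without expanding the series. *)
Lemma logS_uniq f g : f`_0 = 1 -> g`_0 = 0 -> tr N (g^`() * f) = tr N f^`() ->
  forall j, (j < N.+1)%N -> g`_j = (logS N.+1 f)`_j.
Proof.
move=> f0 g0 e; have fi : tr N (invS N f) * tr N f = 1.
  by apply: tr_invS; rewrite // f0 oner_eq0.
have : tr N g^`() = tr N (logS N.+1 f)^`().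
  have : tr N (g^`() * f) = tr N ((logS N.+1 f)^`() * f) by rewrite e logS_deriv.
  by rewrite !rmorphM /= => h; rewrite -[LHS]mulr1 -[RHS]mulr1 -fi mulrCA h mulrCA.
move/(trP _ _ N_gt0) => d [|j]; first by rewrite g0 logS_coef0.
rewrite ltnS => jN; have /eqP := d j jN; rewrite !coef_deriv -subr_eq0 -mulrnBl.
by rewrite -mulr_natr mulf_eq0 (negbTE (charF _)) // orbF subr_eq0 => /eqP.
Qed.

Lemma logS_tr f g : f`_0 = 1 -> tr N.+1 f = tr N.+1 g ->
  forall j, (j < N.+1)%N -> (logS N.+1 f)`_j = (logS N.+1 g)`_j.
Proof.
move=> f0 fg; have g0 : g`_0 = 1 by have/trP/(_ 0%N) := fg; rewrite f0 => <-.
apply: logS_uniq; rewrite ?logS_coef0 // rmorphM /=.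
have fgN : tr N f = tr N g by apply: tr_mono fg; rewrite N_gt0 leqnSn.
by rewrite -fgN -rmorphM /= logS_deriv // (tr_deriv N_gt0 fg).
Qed.

Lemma logS_mul f g : f`_0 = 1 -> g`_0 = 1 -> forall j, (j < N.+1)%N ->
  (logS N.+1 (f * g))`_j = (logS N.+1 f)`_j + (logS N.+1 g)`_j.
Proof.
move=> f0 g0 j jN; rewrite -coefD; apply/esym/(logS_uniq _ _ _ jN).
- by rewrite coefM0 f0 g0 mulr1.
- by rewrite coefD !logS_coef0 ?addr0.
have -> : (logS N.+1 f + logS N.+1 g)^`() * (f * g) =
    ((logS N.+1 f)^`() * f) * g + f * ((logS N.+1 g)^`() * g).
  by rewrite derivD; ring.
rewrite derivM !rmorphD [X in X + _]rmorphM [X in _ + X]rmorphM /=.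
by rewrite !logS_deriv // !rmorphM.
Qed.

Lemma logS_prod (I : Type) (s : seq I) (P : pred I) (G : I -> {poly F}) :
  (forall i, P i -> (G i)`_0 = 1) -> forall j, (j < N.+1)%N ->
  (logS N.+1 (\prod_(i <- s | P i) G i))`_j = \sum_(i <- s | P i) (logS N.+1 (G i))`_j.
Proof.
move=> G0 j jN; elim: s => [|i s IH].
  (* The empty product: log 1 = 0 is read off from log (1 * 1) = log 1 + log 1. *)
  rewrite !big_nil; have := @logS_mul 1 1; rewrite mulr1 coef1 => /(_ erefl erefl j jN).
  by move/(congr1 (fun x => x - (logS N.+1 1)`_j)); rewrite subrr addrK => <-.
rewrite !big_cons; case: ifP => // Pi; rewrite logS_mul ?IH ?G0 //.
by elim/big_rec: _ => [|k x Pk]; rewrite ?coef1 // coefM0 G0 // mul1r.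
Qed.

(** The coefficient of s^j in f' = (log f)' f; this is the recurrence run by [cexp_coefs]. *)
Lemma logS_rec f j : f`_0 = 1 -> (j < N)%N ->
  f`_j.+1 *+ j.+1 = \sum_(i <- iota 1 j.+1) (i%:R * (logS N.+1 f)`_i) * f`_(j.+1 - i).
Proof.
move=> f0 jN; have /(trP _ _ N_gt0)/(_ j jN) := logS_deriv f0; rewrite coef_deriv => <-.
rewrite -[iota 1 _]/(index_iota 1 j.+2) big_add1 big_mkord coefM.
by apply: eq_bigr => i _; rewrite coef_deriv subSS mulr_natl.
Qed.

End Log.

(** * Values and costs of the counted operations *)

Section Counted.

Lemma value_cbind (A B : Type) (x : counted A) (k : A -> counted B) :
  value (cbind x k) = value (k (value x)).
Proof. by []. Qed.

Lemma cost_cbind (A B : Type) (x : counted A) (k : A -> counted B) :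
  cost (cbind x k) = (cost x + cost (k (value x)))%N.
Proof. by []. Qed.

Lemma value_cmap (A B : Type) (f : A -> counted B) s :
  value (cmap f s) = [seq value (f x) | x <- s].
Proof. by elim: s => //= x s <-. Qed.

Lemma cost_cmap (A B : Type) (f : A -> counted B) s :
  cost (cmap f s) = (\sum_(x <- s) cost (f x))%N.
Proof.
elim: s => [|x s IH]; rewrite ?big_nil // big_cons -IH.
by rewrite [LHS]cost_cbind cost_cbind addn0.
Qed.

Variable F : fieldType.

Lemma value_csum (s : seq F) : value (csum s) = \sum_(x <- s) x.
Proof. by elim: s => [|x s IH]; rewrite ?big_nil ?big_cons //= -IH. Qed.

Lemma cost_csum (s : seq F) : cost (csum s) = size s.
Proof. by elim: s => // x s IH; rewrite [LHS]cost_cbind IH addn1. Qed.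

Lemma value_cprod (s : seq F) : value (cprod s) = \prod_(x <- s) x.
Proof. by elim: s => [|x s IH]; rewrite ?big_nil ?big_cons //= -IH. Qed.

Lemma cost_cprod (s : seq F) : cost (cprod s) = size s.
Proof. by elim: s => // x s IH; rewrite [LHS]cost_cbind IH addn1. Qed.

Lemma value_cpow (x : F) k : value (cpow x k) = x ^+ k.
Proof. by rewrite value_cprod big_nseq -Monoid.iteropE. Qed.

Lemma cost_cpow (x : F) k : cost (cpow x k) = k.
Proof. by rewrite cost_cprod size_nseq. Qed.

Lemma cexp_coefsS (l : seq F) J :
  cexp_coefs l J.+1 =
    let! f := cexp_coefs l J in
    let! t := cmap (fun i => let! u := cmul i%:R l`_i in cmul u f`_(J.+1 - i))
                   (iota 1 J.+1) in
    let! u := csum t in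
    let! fJ := cdiv u J.+1%:R in
    cret (rcons f fJ).
Proof. by []. Qed.

Lemma value_cexp_coefsS (l : seq F) J :
  value (cexp_coefs l J.+1) = rcons (value (cexp_coefs l J))
    ((\sum_(i <- iota 1 J.+1) i%:R * l`_i * (value (cexp_coefs l J))`_(J.+1 - i)) / J.+1%:R).
Proof. by rewrite cexp_coefsS 4!value_cbind value_csum value_cmap big_map. Qed.

(** Computing f_j takes 2 j multiplications, j additions and one division, that is 3 j + 1
    operations. *)
Lemma cost_cexp_coefs (l : seq F) J : (cost (cexp_coefs l J) <= 2 * J.+1 ^ 2)%N.
Proof.
elim: J => // J IH; rewrite cexp_coefsS 4!cost_cbind cost_csum value_cmap size_map size_iota.
rewrite cost_cmap; under eq_bigr do rewrite /=.
rewrite big_const_seq count_predT size_iota iter_addn_0 /=; lia.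
Qed.

Lemma value_cexp_coefs N (l : seq F) (f : {poly F}) J :
  (0 < N)%N -> natr_unit F N -> f`_0 = 1 -> (J <= N)%N ->
  (forall j, (j <= J)%N -> l`_j = (logS N.+1 f)`_j) ->
  value (cexp_coefs l J) = [seq f`_j | j <- iota 0 J.+1].
Proof.
move=> N0 charF f0; elim: J => [|J IH] JN lE; first by rewrite /= f0.
rewrite value_cexp_coefsS IH; first last.
- by move=> j jJ; apply: lE; apply: leqW.
- exact: ltnW.
have -> : iota 0 J.+2 = rcons (iota 0 J.+1) J.+1 by rewrite -[J.+2]addn1 iotaD cats1.
rewrite map_rcons; congr rcons.
have J1 : J.+1%:R != 0 :> F by apply: charF; rewrite JN.
apply: (mulIf J1); rewrite divfK // mulr_natr (logS_rec N0) //.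
apply: eq_big_seq => i; rewrite mem_iota => /andP[i0 iJ].
rewrite lE //; congr (_ * _); rewrite (nth_map 0%N) ?size_iota; last by lia.
by rewrite nth_iota //; lia.
Qed.
End Counted.

(** * Residues *)

Lemma tr_coef0 (F : fieldType) N (f g h : {poly F}) : (0 < N)%N ->
  tr N f * tr N g = tr N h -> f`_0 * g`_0 = h`_0.
Proof.
by move=> N0; rewrite -rmorphM -coefM0 => /(trP _ _ N0); apply.
Qed.

Lemma expS_coef0 (F : fieldType) N (c : F) : (0 < N)%N -> (expS N c)`_0 = 1.
Proof. by move=> N0; rewrite coef_expS N0 expr0 divr1. Qed.

Lemma toddS_coef0 (F : fieldType) N : (0 < N)%N -> (toddS F N)`_0 = 1.
Proof.
move=> N0; have : tr N (toddS F N) * tr N (bernS F N) = tr N 1.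
  by rewrite tr_toddS // rmorph1.
by move/(tr_coef0 N0); rewrite coef1 [(bernS F N)`_0]coef_poly N0 invr1 mulr1.
Qed.

Lemma ratioS_coef0 (F : fieldType) N (c : F) : (0 < N)%N -> c != 1 ->
  (ratioS N c)`_0 = 1.
Proof.
move=> N0 c1; have c1' : 1 - c != 0 by rewrite subr_eq0 eq_sym.
have /(tr_coef0 N0) : tr N (ratioS N c) * tr N (1 - c *: expS N 1) = tr N (1 - c)%:A.
  by rewrite tr_ratioS // linearZ /= rmorph1.
by rewrite !coefE N0 expr0 invr1 !mulr1 => /(canRL (mulfK c1')) ->; rewrite divff.
Qed.

Lemma tr_coefXM (F : fieldType) N (f g : {poly F}) j : (0 < N)%N -> (j <= N)%N ->
  tr N f = tr N g -> ('X * f)`_j = ('X * g)`_j.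
Proof.
by move=> N0 jN /(trP _ _ N0) fg; rewrite !coefXM; case: j jN => //= j /fg.
Qed.

Lemma div_neq1 (F : fieldType) (a b : F) : a != 0 -> b != a -> b / a != 1.
Proof.
by move=> a0 ba; rewrite -subr_eq0 -(divff a0) -mulrBl mulf_neq0 ?invr_eq0 // subr_eq0.
Qed.

Section Residues.
Variables (F : finFieldType) (N : nat).
Hypotheses (N_gt0 : (0 < N)%N) (charF : natr_unit F N).
Implicit Types (a b c x : F) (xs : seq F) (g : {poly F}).

(* Minus the residue at infinity of g dX / prod_(x <- xs) (X - x). *)
Definition resinf xs g : F :=
  (g %% \prod_(x <- xs) ('X - x%:P))`_(size xs).-1.

(* The inverse of a e^(-s) - x, multiplied by s when x = a. *)
Definition invfactS a x : {poly F} :=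
  if x == a then - a^-1 *: (expS N 1 * toddS F N)
  else (a - x)^-1 *: (expS N 1 * ratioS N (x / a)).

(* g dX / prod_(x <- xs) (X - x) at X = a e^(-s), multiplied by s ^ mu_a / ds. *)
Definition locS xs a g : {poly F} :=
  (- a *: expS N (-1)) * (g \Po (a *: expS N (-1))) * \prod_(x <- xs) invfactS a x.

(* The coefficient of s ^ (mu_a - 1) in locS; the factor 'X makes it 0 when
   mu_a = 0. *)
Definition residue xs a g : F := ('X * locS xs a g)`_(count_mem a xs).

Lemma tr_invfactS_neq a x : a != 0 -> x != a ->
  tr N (invfactS a x) * tr N (a *: expS N (-1) - x%:P) = 1.
Proof.
move=> a0 xa; rewrite /invfactS (negbTE xa).
have xa1 := div_neq1 a0 xa.
have -> : tr N ((a - x)^-1 *: (expS N 1 * ratioS N (x / a))) *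
   tr N (a *: expS N (-1) - x%:P) = (a - x)^-1 *: (tr N (ratioS N (x / a)) *
  tr N (expS N 1 * (a *: expS N (-1) - x%:P))).
  by rewrite linearZ /= -scalerAl !rmorphM /=; congr (_ *: _); ring.
have -> : tr N (expS N 1 * (a *: expS N (-1) - x%:P)) =
          tr N (a *: (1 - x / a *: expS N 1)).
  have EE : tr N (expS N (1 : F) * expS N (-1)) = tr N 1.
    by rewrite rmorphM tr_expSN // rmorph1.
  have -> : expS N 1 * (a *: expS N (-1) - x%:P) =
    a *: (expS N 1 * expS N (-1) - (x / a) *: expS N 1).
    rewrite mulrBr -scalerAr [_ * x%:P]mulrC mul_polyC scalerBr scalerA.
    by rewrite [a * _]mulrC divfK.
  rewrite [LHS]linearZ [RHS]linearZ; congr (_ *: _).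
  by rewrite !rmorphB /= EE.
rewrite linearZ /= -scalerAr tr_ratioS // !scalerA -[RHS]scale1r; congr (_ *: _).
by field; rewrite a0 subr_eq0 eq_sym.
Qed.

Lemma tr_invfactS_eq a : a != 0 ->
  tr N (invfactS a a) * tr N (a *: expS N (-1) - a%:P) = tr N 'X.
Proof.
move=> a0; rewrite /invfactS eqxx.
rewrite -rmorphM -scalerAl.
have -> : expS N 1 * toddS F N * (a *: expS N (-1) - a%:P) =
  a *: (toddS F N * (expS N 1 * expS N (-1) - expS N 1)).
  by rewrite -mul_polyC -[a *: (toddS F N * _)]mul_polyC; ring.
rewrite scalerA mulNr mulVf // scaleN1r rmorphN rmorphM rmorphB rmorphM /= tr_expSN //.
have : tr N (expS N.+1 1 - 1) = tr N ('X * bernS F N).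
  by rewrite expS_bernS !scale1r comp_polyXr.
rewrite rmorphB rmorph1 rmorphM /= tr_mono_expS ?N_gt0 ?leqnSn // => XB.
by rewrite -mulrN opprB XB mulrCA tr_toddS // mulr1.
Qed.

Lemma locS_XsubC xs a c g :
  tr N (locS (c :: xs) a (('X - c%:P) * g)) =
  tr N (invfactS a c) * tr N (a *: expS N (-1) - c%:P) * tr N (locS xs a g).
Proof.
rewrite /locS big_cons comp_polyM comp_polyB comp_polyX comp_polyC.
by rewrite !rmorphM /=; ring.
Qed.

(** A factor X - c common to numerator and denominator is invisible to local residues. For a <> c
    its expansion cancels against its inverse; for a = c a factor s survives, which matches the pole
    order increased by one. *)
Lemma residue_XsubC xs a c g : c != 0 -> (size xs < N)%N ->
  residue (c :: xs) a (('X - c%:P) * g) = residue xs a g.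
Proof.
move=> c0 sN; rewrite /residue /=; set k := count_mem a xs.
have kN : (k < N)%N := leq_ltn_trans (count_size _ _) sN.
have [ca|ca] := eqVneq c a; last first.
  (* At a = 0 the parametrisation degenerates, but the factor [- a] of [locS] makes both sides 0. *)
  have [a0|a0] := eqVneq a 0; first by rewrite /locS a0 oppr0 scale0r !mul0r !mulr0 !coef0.
  by apply: (tr_coefXM N_gt0 (ltnW kN)); rewrite locS_XsubC tr_invfactS_neq ?mul1r.
rewrite ca in c0 *; rewrite add1n coefXM /=.
have /(trP _ _ N_gt0)/(_ k kN) -> // :
    tr N (locS (a :: xs) a (('X - a%:P) * g)) = tr N ('X * locS xs a g).
by rewrite locS_XsubC tr_invfactS_eq // [RHS]rmorphM.
Qed.

Lemma residueD xs a g h : residue xs a (g + h) = residue xs a g + residue xs a h.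
Proof. by rewrite /residue /locS comp_polyD mulrDr mulrDl mulrDr coefD. Qed.

Lemma residueZ xs a c g : residue xs a (c *: g) = c * residue xs a g.
Proof. by rewrite /residue /locS comp_polyZ -scalerAr -scalerAl -scalerAr coefZ. Qed.

Lemma residue_perm xs ys a g : perm_eq xs ys -> residue xs a g = residue ys a g.
Proof.
by move=> e; rewrite /residue /locS (perm_big _ e) (seq.permP e).
Qed.

Lemma residue_notin xs a g : a \notin xs -> residue xs a g = 0.
Proof. by move/count_memPn => e; rewrite /residue e coefXM. Qed.

Lemma resinfD xs g h : resinf xs (g + h) = resinf xs g + resinf xs h.
Proof. by rewrite /resinf modpD coefD. Qed.

Lemma resinfZ xs c g : resinf xs (c *: g) = c * resinf xs g.
Proof. by rewrite /resinf modpZl coefZ. Qed.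

Lemma resinf_perm xs ys g : perm_eq xs ys -> resinf xs g = resinf ys g.
Proof.
by move=> e; rewrite /resinf (perm_big _ e) (perm_size e).
Qed.

Lemma resinf_small xs g : (size g <= size xs)%N -> resinf xs g = g`_(size xs).-1.
Proof. by move=> sg; rewrite /resinf modp_small // size_prod_XsubC ltnS. Qed.

(** If rho is the remainder of g modulo Q, then (X - c) rho is already reduced modulo (X - c) Q, and
    its top coefficient is that of rho. *)
Lemma resinf_XsubC xs c g : (0 < size xs)%N ->
  resinf (c :: xs) (('X - c%:P) * g) = resinf xs g.
Proof.
move=> s0; rewrite /resinf big_cons; set Q := \prod_(x <- xs) _.
have sQ : size Q = (size xs).+1 by rewrite size_prod_XsubC.
have Q0 : Q != 0 by rewrite -size_poly_eq0 sQ.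
have sr : (size (g %% Q)%R <= size xs)%N by rewrite -ltnS -sQ ltn_modp.
rewrite [in LHS](divp_eq g Q) mulrDr mulrCA modpD modp_mull add0r modp_small.
  rewrite mulrBl coefB coefXM mul_polyC coefZ [in X in _ - X]nth_default ?mulr0 //.
  by rewrite subr0 /=; case: (size xs) s0.
rewrite [X in (_ < X)%N]size_monicM ?monicXsubC // size_XsubC sQ /=.
by apply: leq_ltn_trans (size_polyMleq _ _) _; rewrite size_XsubC.
Qed.

(** The only place where invariance under X = a e^(-s) has to be checked: for a simple pole by
    constant terms, for a higher one by [coef_expS_toddS_pow], the side at infinity being 0 by
    degree. *)
Lemma residue_theorem_const a k c : a != 0 -> (k < N)%N ->
  resinf (nseq k.+1 a) c%:P = residue (nseq k.+1 a) a c%:P.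
Proof.
move=> a0 kN; rewrite resinf_small; last first.
  by rewrite size_nseq; apply: leq_trans (size_polyC_leq1 _) _.
rewrite /residue count_nseq /= eqxx mul1n coefXM /= size_nseq /=.
rewrite -[a :: _]/(nseq k.+1 a) /locS comp_polyC big_nseq iter_mulr_1 /invfactS eqxx.
set u := expS N 1 * _.
rewrite -[_ *: u]mul_polyC -[- a *: _]mul_polyC exprMn -polyC_exp.
have -> : (- a)%:P * expS N (-1) * c%:P * (((- a^-1) ^+ k.+1)%:P * u ^+ k.+1) =
  (- a * c * (- a^-1) ^+ k.+1) *: (expS N (-1) * u ^+ k.+1).
  by rewrite -mul_polyC !polyCM; ring.
rewrite coefZ coefC; case: k kN => [|k] kN.
  rewrite !expr1 !coefM0 !expS_coef0 // toddS_coef0 // !mulr1 /=.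
  by field.
by rewrite (coef_expS_toddS_pow charF (k := k.+2)) ?mulr0.
Qed.

Lemma residue_theorem_nseq a k g : a != 0 -> (k < N)%N ->
  resinf (nseq k.+1 a) g = residue (nseq k.+1 a) a g.
Proof.
move=> a0; elim: k g => [|k IH] g kN.
  rewrite [g](divp_eq g ('X - a%:P)) modp_XsubC resinfD residueD residue_theorem_const //.
  congr (_ + _); rewrite mulrC /= residue_XsubC // residue_notin //.
  by rewrite /resinf big_seq1 modp_mulr coef0.
rewrite [g](divp_eq g ('X - a%:P)) modp_XsubC resinfD residueD residue_theorem_const //.
congr (_ + _); rewrite mulrC -[nseq k.+2 a]/(a :: nseq k.+1 a).
rewrite residue_XsubC ?size_nseq // resinf_XsubC ?size_nseq // IH //.
exact: ltnW.
Qed.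

(* If xs contains a <> b, then g = ((X - b) g - (X - a) g) / (a - b) reduces the
   claim to two shorter sequences; for a constant sequence, g is expanded in
   powers of X - a. *)
Theorem residue_theorem xs g : (0 < size xs <= N)%N -> 0 \notin xs ->
  resinf xs g = \sum_a residue xs a g.
Proof.
have [k] := ubnP (size xs); elim: k xs g => // k IH xs g sk /andP[s0 sN] xs0.
case: xs s0 => // a ys _ in sk sN xs0 *; have a0 : a != 0.
  by apply: contraNneq xs0 => ->; rewrite mem_head.
have [/all_pred1P e|/allPn[b bys /= ba]] := boolP (all (pred1 a) ys).
  rewrite e -[_ :: _]/(nseq (size ys).+1 a) residue_theorem_nseq //.
  rewrite (bigD1 a isT) big1 => [|b ba]; first by rewrite [RHS]addr0.
  apply: residue_notin.
  by rewrite mem_nseq negb_and -[b != a]/(true && (b != a)) ba orbT.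
have b0 : b != 0 by apply: contraNneq xs0 => <-; rewrite inE bys orbT.
set zs := rem b ys.
have ab : perm_eq (a :: ys) [:: a, b & zs] by rewrite perm_cons perm_to_rem.
have ba' : perm_eq (a :: ys) [:: b, a & zs].
  by apply: perm_trans ab _; rewrite -[[:: a, b & _]]/([:: a] ++ [:: b] ++ zs) perm_catCA.
have szs : (size zs).+2 = (size ys).+1 by have := perm_size ab.
have zs0 : 0 \notin zs by apply: contra xs0 => /mem_rem; rewrite inE orbC => ->.
have gE : g = (a - b)^-1 *: (('X - b%:P) * g) + (- (a - b)^-1) *: (('X - a%:P) * g).
  rewrite scaleNr -scalerBr -mulrBl.
  have -> : 'X - b%:P - ('X - a%:P) = (a - b)%:P by rewrite polyCB; ring.
  by rewrite mul_polyC scalerA mulVf ?scale1r // subr_eq0 eq_sym.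
have Ib : resinf (a :: ys) (('X - b%:P) * g) = resinf (a :: zs) g.
  by rewrite (resinf_perm _ ba') resinf_XsubC.
have Ia : resinf (a :: ys) (('X - a%:P) * g) = resinf (b :: zs) g.
  by rewrite (resinf_perm _ ab) resinf_XsubC.
have Rb c : residue (a :: ys) c (('X - b%:P) * g) = residue (a :: zs) c g.
  by rewrite (residue_perm _ _ ba') residue_XsubC //= szs.
have Ra c : residue (a :: ys) c (('X - a%:P) * g) = residue (b :: zs) c g.
  by rewrite (residue_perm _ _ ab) residue_XsubC //= szs.
rewrite gE resinfD !resinfZ Ia Ib.
under eq_bigr do rewrite residueD !residueZ Ra Rb.
rewrite big_split /= -!mulr_sumr !IH //= ?szs ?inE ?negb_or 1?eq_sym ?a0 ?b0 ?(ltnW sN) //.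
all: by move: sk sN; rewrite /= -szs; move: (size zs) => z; lia.
Qed.
End Residues.

(** * Complete homogeneous polynomials as coefficients and as residues at infinity *)

Section CompleteHomogeneous.
Variable F : fieldType.
Implicit Types (x c : F) (xs : seq F).

Definition geomS N x : {poly F} := \poly_(k < N) x ^+ k.

(** The h_j through their generating function, the product of the 1 / (1 - x s). Taking a sequence
    of values makes symmetry and induction on the variables immediate. *)
Definition hseq j xs : F := (\prod_(x <- xs) geomS j.+1 x)`_j.

Lemma tr_geomS_mono N' N x : (0 < N' <= N)%N -> tr N' (geomS N x) = tr N' (geomS N' x).
Proof.
case/andP=> N'0 le; apply/trP => // j jN.
by rewrite !coef_poly jN (leq_trans jN).
Qed.

Lemma hseq_prec N j xs : (j < N)%N -> hseq j xs = (\prod_(x <- xs) geomS N x)`_j.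
Proof.
move=> jN; have /trP : tr j.+1 (\prod_(x <- xs) geomS N x) =
                       tr j.+1 (\prod_(x <- xs) geomS j.+1 x).
  by rewrite !rmorph_prod; apply: eq_bigr => x _ /=; rewrite tr_geomS_mono.
by move=> -> //; apply: ltnSn.
Qed.

Lemma hseq0 xs : hseq 0 xs = 1.
Proof.
rewrite /hseq; elim: xs => [|x xs IH]; rewrite ?big_nil ?coef1 // big_cons.
by rewrite coefM0 IH coef_poly expr0 mulr1.
Qed.

Lemma hseq_nil j : hseq j [::] = (j == 0%N)%:R.
Proof. by rewrite /hseq big_nil coef1. Qed.

(** Multiplying the generating function by 1 - x s removes the variable x. *)
Lemma hseqS j x xs : hseq j.+1 (x :: xs) = hseq j.+1 xs + x * hseq j (x :: xs).
Proof.
rewrite (@hseq_prec j.+2 j) // /hseq big_cons; set P := \prod_(y <- xs) _.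
have : tr j.+2 ((1 - x *: 'X) * geomS j.+2 x) = tr j.+2 1.
  apply/trP => // -[|i] ij; rewrite mulrBl mul1r -scalerAl coefB coefZ coefXM coef1.
    by rewrite coef_poly mulr0 subr0.
  by rewrite !coef_poly ij (ltnW ij) exprS subrr.
move/(congr1 (fun q => q * tr j.+2 P)); rewrite -!rmorphM mul1r /=.
move/(trP _ _ (ltn0Sn _))/(_ j.+1 (ltnSn _)).
rewrite -mulrA mulrBl mul1r -scalerAl coefB coefZ coefXM /= => <-.
by rewrite subrK.
Qed.

Lemma hseq_perm j xs ys : perm_eq xs ys -> hseq j xs = hseq j ys.
Proof. by move=> e; rewrite /hseq (perm_big _ e). Qed.

(** The restriction [Q] on exponents serves two uses: no restriction gives h_j itself, and a zero
    exponent at i gives the rows of a matrix with zero diagonal. *)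
Lemma hseqE n j (x : 'I_n -> F) (Q : 'I_n -> pred 'I_j.+1) :
  (\prod_i \sum_(k < j.+1 | Q i k) (x i ^+ k) *: 'X^k)`_j =
  \sum_(f : {ffun 'I_n -> 'I_j.+1} | [forall i, Q i (f i)] &&
     ((\sum_i f i)%N == j)) \prod_i x i ^+ f i.
Proof.
rewrite bigA_distr_big_dep coef_sum.
rewrite [RHS]big_mkcond [LHS]big_mkcond; apply: eq_bigr => f _.
have -> : (f \in family Q) = [forall i, Q i (f i)].
  by apply/familyP/forallP => h i; have := h i; rewrite unfold_in.
have -> : \prod_i (x i ^+ f i *: 'X^(f i)) =
    (\prod_i x i ^+ f i) *: 'X^(\sum_i f i) :> {poly F}.
  by rewrite scaler_prod prodrXr.
by rewrite coefZ coefXn eq_sym; case: forallP => //= _; case: eqP; rewrite ?mulr1 ?mulr0.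
Qed.

Lemma hsym_eval n j xs : size xs = n ->
  (hsym F n j).@[fun i => xs`_i] = hseq j xs.
Proof.
(* When the degree of f exceeds j, [insubd] returns the zero monomial; such f fail h' (h f) = f and
   drop out of the reindexing. *)
move=> sx; pose h (f : {ffun 'I_n -> 'I_j.+1}) : 'X_{1..n < j.+1} :=
  insubd bm0 [multinom (f i : nat) | i < n].
pose h' (u : 'X_{1..n < j.+1}) : {ffun 'I_n -> 'I_j.+1} := [ffun i => inord (u i)].
have degf (f : {ffun 'I_n -> 'I_j.+1}) :
    mdeg [multinom (f i : nat) | i < n] = (\sum_i f i)%N.
  by rewrite mdegE; apply: eq_bigr => i _; rewrite mnmE.
have le_mdeg (u : 'X_{1..n}) i : (u i <= mdeg u)%N.
  by rewrite mdegE (bigD1 i) //= leq_addr.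
have hK (u : 'X_{1..n < j.+1}) : mdeg u == j -> h (h' u) = u.
  move=> uj; have e : [multinom (h' u i : nat) | i < n] = u.
    apply/mnmP => i; rewrite mnmE ffunE inordK // ltnS.
    by rewrite (leq_trans (le_mdeg u i)) // (eqP uj).
  by apply: val_inj; rewrite /h e val_insubd; case: ifP => //; rewrite bmdeg.
rewrite /hsym raddf_sum (reindex_onto h h') //.
transitivity (\prod_(i < n) \sum_(k < j.+1) (xs`_i ^+ k) *: 'X^k)`_j; last first.
  rewrite /hseq [in RHS](big_nth 0) big_mkord sx.
  by congr ((_ : {poly F})`_j); apply: eq_bigr => i _; rewrite /geomS poly_def.
rewrite (hseqE _ (fun _ => predT)); apply: eq_big => f.
  have -> : [forall i, predT (f i)] by apply/forallP.
  apply/andP/eqP => [[/eqP dh /eqP hf]|sf].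
    have uE i : h f i = f i :> nat.
      by rewrite -{2}hf ffunE inordK // ltnS (leq_trans (le_mdeg _ i)) // dh.
    by apply: (etrans _ dh); rewrite mdegE; apply: eq_bigr => i _; rewrite uE.
  have e : val (h f) = [multinom (f i : nat) | i < n].
    by rewrite /h val_insubd degf sf ltnSn.
  split; first by rewrite e degf sf.
  by apply/eqP/ffunP => i; apply: val_inj; rewrite ffunE e mnmE inord_val.
move=> /andP[/eqP dh /eqP hf]; rewrite [LHS]mevalX; apply: eq_bigr => i _.
by rewrite -{2}hf ffunE inordK // ltnS (leq_trans (le_mdeg _ i)) // dh.
Qed.
End CompleteHomogeneous.

(** Splitting X^(k+1) = (X - x) X^k + x X^k and cancelling X - x reproduces the recurrence
    [hseqS]. *)
Lemma resinf_Xn (F : finFieldType) (xs : seq F) j : (0 < size xs)%N ->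
  resinf xs 'X^((size xs).-1 + j) = hseq j xs.
Proof.
case: xs => // x xs _; elim: xs x j => [|y xs IH] x j.
  rewrite /resinf big_seq1 modp_XsubC add0n hornerXn coefC /=.
  elim: j => [|j IH]; rewrite ?hseq0 // hseqS hseq_nil add0r -IH.
  by rewrite exprS.
elim: j => [|j IHj].
  by rewrite hseq0 addn0 resinf_small ?size_polyXn // coefXn eqxx.
rewrite hseqS -IHj -IH addnS; set k := ((size _).-1 + j)%N.
have -> : 'X^(k.+1) = ('X - x%:P) * 'X^k + x *: 'X^k by rewrite -mul_polyC exprS; ring.
by rewrite resinfD resinfZ resinf_XsubC // /k /= addSnnS.
Qed.

(** * Local expansions at the entries of a multiset *)

Section Multiset.
Variables (F : finFieldType) (n r : nat) (M : {ffun F -> 'I_n.+1}).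
Hypothesis MP : M \in Msets F n r.

Lemma Omega_neq0 a : a \in Omega F r -> a != 0.
Proof. by apply: contraTneq => ->; rewrite inE expr0n eq_sym oner_eq0. Qed.

Lemma sum_Msets : (\sum_(a in Omega F r) (M a : nat))%N = n.
Proof. by move: MP; rewrite inE => /andP[_ /eqP]. Qed.

Lemma Msets_notin a : a \notin Omega F r -> M a = 0%N :> nat.
Proof. by move: MP; rewrite inE => /andP[/forallP/(_ a)/implyP h _] /h /eqP. Qed.

Lemma big_entries (R : Type) (idx : R) (op : Monoid.com_law idx) (f : F -> R) :
  \big[op/idx]_(x <- entries r M) f x =
  \big[op/idx]_(a in Omega F r) iter (M a) (op (f a)) idx.
Proof.
rewrite /entries big_flatten big_map big_enum_cond /=.
by apply: eq_big => [a|a _]; rewrite ?andbT // big_nseq.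
Qed.

Lemma prod_entries (R : comPzSemiRingType) (f : F -> R) :
  \prod_(x <- entries r M) f x = \prod_(a in Omega F r) f a ^+ M a.
Proof. by rewrite big_entries; apply: eq_bigr => a _; rewrite iter_mulr_1. Qed.

Lemma count_entries a : count_mem a (entries r M) = M a.
Proof.
rewrite -sum1_count big_mkcond big_entries /=.
under eq_bigr do rewrite iter_addn_0.
have [aO|aO] := boolP (a \in Omega F r).
  rewrite (bigD1 a) //= eqxx mul1n big1 ?addn0 // => b /andP[_ /negbTE ->].
  exact: mul0n.
rewrite Msets_notin // big1 // => b bO; case: eqP => [e|//].
by rewrite -e bO in aO.
Qed.

Lemma size_entries : size (entries r M) = n.
Proof.
rewrite -sum1_size big_entries -[RHS]sum_Msets; apply: eq_bigr => a _.
by rewrite iter_addn_0 mul1n.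
Qed.

Lemma entries_notin a : a \notin Omega F r -> a \notin entries r M.
Proof. by move/Msets_notin => e; apply/count_memPn; rewrite count_entries. Qed.

Lemma hM_hseq j : hM r j M = hseq j (entries r M).
Proof. exact: hsym_eval size_entries. Qed.

Hypotheses (n_gt1 : (1 < n)%N) (charF : natr_unit F n).

Lemma prod_invfactS a : a \in Omega F r ->
  \prod_(b in Omega F r) invfactS n a b ^+ M b =
  ((- a^-1) ^+ M a * \prod_(b in Omega F r | b != a) (a - b)^-1 ^+ M b) *:
  (expS n 1 ^+ n *
   (toddS F n ^+ M a * \prod_(b in Omega F r | b != a) ratioS n (b / a) ^+ M b)).
Proof.
move=> aO; pose k b := if b == a then - a^-1 else (a - b)^-1.
pose R b := if b == a then toddS F n else ratioS n (b / a).
have -> : \prod_(b in Omega F r) invfactS n a b ^+ M b =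
   \prod_(b in Omega F r) (k b ^+ M b *: (expS n 1 ^+ M b * R b ^+ M b)).
  apply: eq_bigr => b _; rewrite -exprMn -exprZn /invfactS /k /R.
  by case: eqP.
rewrite scaler_prod big_split /= prodrXr sum_Msets.
congr (_ *: (_ * _)).
  rewrite (bigD1 a) //= /k eqxx; congr (_ * _).
  by apply: eq_bigr => b /andP[_ /negbTE ->].
rewrite (bigD1 a) //= /R eqxx; congr (_ * _).
by apply: eq_bigr => b /andP[_ /negbTE ->].
Qed.

(** A count of powers of a: n - 1 - d from the numerator and dX, - mu_a from the pole, - (n - mu_a)
    from writing each a - b as a (1 - b / a). The total is - 1 - d. *)
Lemma Clocal_scalar a d : a \in Omega F r -> (d <= n - 2)%N ->
  - a * a ^+ (n - 2 - d) * ((- a^-1) ^+ M a *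
     \prod_(b in Omega F r | b != a) (a - b)^-1 ^+ M b) * - r.+1%:R =
  Clocal r M a / a ^+ d.
Proof.
move=> aO dn; have a0 := Omega_neq0 aO.
have -> : \prod_(b in Omega F r | b != a) (a - b)^-1 ^+ M b =
  a ^- (n - M a) * \prod_(b in Omega F r | b != a) (1 - b / a)^-1 ^+ M b.
  have -> : (n - M a = \sum_(b in Omega F r | b != a) M b)%N.
    by have := sum_Msets; rewrite (bigD1 a) //=; lia.
  rewrite -exprVn -prodrXr -big_split /=; apply: eq_bigr => b _.
  by rewrite -exprMn -invfM mulrBr mulr1 [a * _]mulrC divfK.
rewrite /Clocal [(- a^-1) ^+ _]exprNn exprVn; set P := \prod_(b in _ | _) _.
set x := a ^+ (n - 2 - d); set y := a ^+ d; set u := a ^- M a; set v := a ^- (n - M a).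
have uv : u * v * (x * y * a ^+ 2) = 1.
  rewrite /u /v -invfM -exprD subnKC; last by rewrite -ltnS ltn_ord.
  rewrite /x /y -!exprD.
  by rewrite subnK // subnK // mulVf // expf_neq0.
have [x0 y0] : x != 0 /\ y != 0 by rewrite !expf_neq0.
transitivity ((-1) ^+ M a * r.+1%:R * P * (a * x) * (u * v)); first by ring.
have -> : u * v = (x * y * a ^+ 2)^-1.
  have z0 : x * y * a ^+ 2 != 0 by rewrite !mulf_neq0 // expf_neq0.
  by apply: (mulIf z0); rewrite uv mulVf.
by field; rewrite a0 x0 y0.
Qed.

(** The exponentials combine to e^((d+1)s) (e^(-ms) - 1) = - e^((d-r)s) (e^(ms) - 1), and e^(ms) - 1
    = m s / T(ms) supplies the factor ['X]. The index d enters only through e^(ds) / a^d. *)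
Lemma tr_locS a d : a \in Omega F r -> (d <= n - 2)%N ->
  tr n (locS n (entries r M) a ('X^(n - 2 - d) * ('X^(r.+1) - 1))) =
  (Clocal r M a / a ^+ d) *: tr n ('X * (expS n d%:R *
   (expS n (- r%:R) * toddS F n ^+ M a * (bernS F n \Po (r.+1%:R *: 'X)) *
     \prod_(b in Omega F r | b != a) ratioS n (b / a) ^+ M b))).
Proof.
move=> aO dn; set e : {poly F} := expS n (-1); set E : {poly F} := expS n 1.
have n0 : (0 < n)%N by lia.
have am : a ^+ r.+1 = 1 by apply/eqP; move: aO; rewrite inE.
rewrite /locS prod_entries prod_invfactS // -/e -/E.
rewrite comp_polyM comp_polyB !comp_Xn_poly comp_polyC !exprZn am scale1r.
set w : F := (- a^-1) ^+ M a * _; set T : {poly F} := toddS F n ^+ _.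
set Q : {poly F} := \prod_(b in _ | _) ratioS _ _ ^+ _.
set B : {poly F} := bernS F n \Po _.
rewrite -(Clocal_scalar aO dn) -/w.
have -> : - a *: e * (a ^+ (n - 2 - d) *: e ^+ (n - 2 - d) * (e ^+ r.+1 - 1)) *
   (w *: (E ^+ n * (T * Q))) =
   (- a * a ^+ (n - 2 - d) * w) *:
     (e ^+ (n - 2 - d).+1 * (e ^+ r.+1 - 1) * E ^+ n * (T * Q)).
  rewrite [e ^+ (n - 2 - d).+1]exprS -!mul_polyC !polyCM.
  move: e w T Q (a ^+ _) (e ^+ r.+1) (E ^+ n) (e ^+ (n - _ - _)) => *; ring.
rewrite linearZ /= -[in RHS]scalerA; congr (_ *: _).
pose A c := tr n (expS n c : {poly F}).
have AD c c' : A (c + c') = A c * A c' by apply: tr_expSD.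
have AX k : tr n e ^+ k = A (- k%:R) by rewrite tr_expSX // /A mulNrn.
have EX k : tr n E ^+ k = A k%:R by rewrite tr_expSX.
have Am : A r.+1%:R - 1 = r.+1%:R *: tr n ('X * B).
  rewrite -linearZ /= -expS_bernS rmorphB rmorph1 /= tr_mono_expS //.
  by rewrite n0 leqnSn.
have key : tr n (e ^+ (n - 2 - d).+1 * (e ^+ r.+1 - 1) * E ^+ n) =
    - r.+1%:R *: (tr n ('X * B) * (A d%:R * A (- r%:R))).
  rewrite scaleNr scalerAl -Am !rmorphM rmorphB rmorph1 !rmorphXn /= !AX EX.
  have -> : A n%:R = A (n - 2 - d).+1%:R * A d.+1%:R.
    by rewrite -AD -natrD; congr (A _%:R); lia.
  have A1 : A (- (n - 2 - d).+1%:R) * A (n - 2 - d).+1%:R = 1.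
    by rewrite -AD addNr /A expS0 // rmorph1.
  have -> : A (- r.+1%:R) = A (- r%:R) * A (- 1) by rewrite -AD -opprD natr1.
  have -> : A r.+1%:R = A r%:R * A 1 by rewrite -AD natr1.
  have -> : A d.+1%:R = A d%:R * A 1 by rewrite -AD natr1.
  have Ar : A (- r%:R) * A r%:R = 1 by rewrite -AD addNr /A expS0 // rmorph1.
  have A11 : A (- 1) * A 1 = 1 by rewrite -AD addNr /A expS0 // rmorph1.
  move: (A _) (A _) (A _) (A _) (A _) (A _) (A _) A1 Ar A11 => {AX EX Am}.
  move=> A0 A1 A2 A3 A4 A5 A6 e65 e43 e21.
  transitivity ((A6 * A5) * (A0 * (A4 * (A2 * A1) - A1))); first by ring.
  by rewrite e65 e21 mulr1 mul1r -[A1 in LHS]mul1r -[in LHS]e43; ring.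
have -> : tr n (e ^+ (n - 2 - d).+1 * (e ^+ r.+1 - 1) * E ^+ n * (T * Q)) =
   tr n (e ^+ (n - 2 - d).+1 * (e ^+ r.+1 - 1) * E ^+ n) * tr n (T * Q).
  by rewrite -rmorphM.
rewrite key -scalerAl; congr (_ *: _); rewrite /A.
have -> : 'X * (expS n d%:R * (expS n (- r%:R) * T * B * Q)) =
   ('X * B) * (expS n d%:R * expS n (- r%:R)) * (T * Q).
  clear Am key; by move: (expS n d%:R) (expS n (- _)) ('X) T B Q => *; ring.
rewrite [RHS]rmorphM; congr (_ * _); rewrite [RHS]rmorphM; congr (_ * _).
by rewrite [RHS]rmorphM.
Qed.

(** One factor ['X] comes from [residue] and one from X^m - 1, so the coefficient wanted is that of
    s^(mu_a - 2). As mu_a <= n, precision n - 1 suffices. *)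
Lemma residue_entries a d : a \in Omega F r -> (d <= n - 2)%N ->
  residue n (entries r M) a ('X^(n - 2 - d) * ('X^(r.+1) - 1)) =
  if (2 <= M a)%N then
    Clocal r M a / a ^+ d * (expS n.-1 d%:R * Flocal r M a)`_(M a - 2) else 0.
Proof.
move=> aO dn; have n0 : (0 < n)%N by lia.
have Man : (M a <= n)%N by rewrite -ltnS.
rewrite /residue count_entries.
set Q : {poly F} := expS n d%:R * (expS n (- r%:R) * toddS F n ^+ M a *
  (bernS F n \Po (r.+1%:R *: 'X)) * \prod_(b in Omega F r | b != a) ratioS n (b / a) ^+ M b).
have := tr_locS aO dn; rewrite -/Q -linearZ /= => /(tr_coefXM n0 Man) ->.
rewrite -scalerAr coefZ !coefXM.
have [M2|M2] := leqP 2 (M a); last first.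
  by move: M2; case: (nat_of_ord (M a)) => [|[|k]] // _; rewrite mulr0.
have -> : (M a : nat) == 0%N = false by lia.
have -> : ((M a).-1 : nat) == 0%N = false by lia.
have -> : (M a).-2 = (M a - 2)%N by lia.
congr (_ * _).
have n1 : (0 < n.-1)%N by lia.
have n1n : (0 < n.-1 <= n)%N by lia.
have /(trP _ _ n1)->// : tr n.-1 Q = tr n.-1 (expS n.-1 d%:R * Flocal r M a).
  have e1 c : tr n.-1 (expS n c) = tr n.-1 (expS n.-1 c) by apply: tr_mono_expS.
  have e2 := tr_mono_toddS F n1n.
  have e3 : tr n.-1 (bernS F n \Po (r.+1%:R *: 'X)) =
            tr n.-1 (invS n.-1 (toddS_at n.-1 r.+1%:R)).
    rewrite tr_todd_atS //; apply: tr_comp_scaleX => //.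
    by apply/trP => // j jN; rewrite !coef_poly jN (leq_trans jN) // leq_pred.
  have e4 : tr n.-1 (\prod_(b in Omega F r | b != a) ratioS n (b / a) ^+ M b) =
            tr n.-1 (\prod_(b in Omega F r | b != a) ratioS n.-1 (b / a) ^+ M b).
    rewrite !rmorph_prod /=; apply: eq_bigr => b /andP[bO ba].
    by rewrite !rmorphXn /= tr_mono_ratioS // (div_neq1 (Omega_neq0 aO)).
  rewrite /Q /Flocal [LHS]rmorphM [RHS]rmorphM /= e1 tr_take //.
  by rewrite !rmorphM !rmorphXn /= e1 e2 e3 e4.
by lia.
Qed.

(* The residue theorem for X^(n-2-d) (X^m - 1): the factor X^m - 1 lowers the
   pole order by one at each root of unity, and its term -1 contributes nothing
   at infinity. *)
Lemma hM_local d : (d <= n - 2)%N -> (d <= r)%N ->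
  hM r (r - d) M = \sum_(a in Omega F r | (2 <= M a)%N)
    Clocal r M a / a ^+ d * (expS n.-1 d%:R * Flocal r M a)`_(M a - 2).
Proof.
move=> dn dr; rewrite hM_hseq -resinf_Xn ?size_entries; last by lia.
have -> : (n.-1 + (r - d) = n - 2 - d + r.+1)%N by lia.
have <- : resinf (entries r M) ('X^(n - 2 - d) * ('X^(r.+1) - 1)) =
   resinf (entries r M) 'X^(n - 2 - d + r.+1).
  rewrite mulrBr mulr1 -exprD -scaleN1r resinfD resinfZ.
  rewrite [X in _ * X]resinf_small ?size_polyXn ?size_entries; last by lia.
  by rewrite coefXn (_ : _ == _ = false) ?mulr0 ?addr0 //; lia.
rewrite (residue_theorem (N := n)) ?size_entries //; [|by lia..|].
  rewrite (bigID (mem (Omega F r))) /= [X in _ + X]big1 ?addr0.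
    by rewrite big_mkcondr; apply: eq_bigr => a aO; rewrite residue_entries.
  by move=> a aO; apply: residue_notin; apply: entries_notin.
by apply: entries_notin; apply: contraL isT => /Omega_neq0; rewrite eqxx.
Qed.

End Multiset.

(** * The local evaluations *)

Lemma coefX0 (F : fieldType) (f : {poly F}) k : (f ^+ k)`_0 = f`_0 ^+ k.
Proof. by rewrite -!horner_coef0 horner_exp. Qed.

Section Evaluation.
Variables (F : finFieldType) (n r : nat) (M : {ffun F -> 'I_n.+1}).
Hypotheses (MP : M \in Msets F n r) (n_gt2 : (2 < n)%N) (charF : natr_unit F n).

Let N1 : (0 < n.-1)%N. Proof. lia. Qed.
Let N2 : (0 < n.-2)%N. Proof. lia. Qed.
(** The lemmas on logarithms hold at precision [N.+1]; they are applied with N = n - 2. *)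
Let N12 : n.-2.+1 = n.-1. Proof. lia. Qed.
Let char2 : natr_unit F n.-2. Proof. by apply: natr_unit_le charF; lia. Qed.

Lemma big_supp (R : Type) (idx : R) (op : Monoid.com_law idx) (P : pred F) (f : F -> R) :
  (forall a, P a -> M a = 0%N :> nat -> f a = idx) ->
  \big[op/idx]_(a <- supp r M | P a) f a = \big[op/idx]_(a in Omega F r | P a) f a.
Proof.
move=> f0; rewrite /supp big_filter_cond big_enum_cond [RHS]big_mkcondr [LHS]big_mkcondr /=.
apply: eq_bigr => a _; case: posnP => //= M0.
by case: ifP => // Pa; rewrite f0.
Qed.

Lemma big_suppT (R : Type) (idx : R) (op : Monoid.com_law idx) (f : F -> R) :
  (forall a, M a = 0%N :> nat -> f a = idx) ->
  \big[op/idx]_(a <- supp r M) f a = \big[op/idx]_(a in Omega F r) f a.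
Proof.
move=> f0; rewrite (@big_supp _ _ _ predT) => [|a _ /f0 //].
by apply: eq_bigl => a; rewrite andbT.
Qed.

Lemma big_poles (R : Type) (idx : R) (op : Monoid.com_law idx) (f : F -> R) :
  \big[op/idx]_(a <- poles r M) f a = \big[op/idx]_(a in Omega F r | (2 <= M a)%N) f a.
Proof. by rewrite /poles big_filter big_enum_cond. Qed.

Lemma inv_todd_at_coef0 c : (invS n.-1 (toddS_at n.-1 c))`_0 = 1 :> F.
Proof.
have /(trP _ _ N1)->// := @tr_todd_atS F _ c N1.
by rewrite coef_comp_scaleX coef_poly N1 invr1 mulr1.
Qed.

Lemma take_poly_coef0 (f : {poly F}) : (take_poly n.-1 f)`_0 = f`_0.
Proof. by rewrite coef_take_poly N1. Qed.

Lemma logS_take (f : {poly F}) j : f`_0 = 1 -> (j < n.-1)%N ->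
  (logS n.-1 (take_poly n.-1 f))`_j = (logS n.-1 f)`_j.
Proof.
move=> f0; rewrite -N12 => jN; apply: logS_tr; rewrite // ?N12 ?take_poly_coef0 //.
exact: tr_take.
Qed.

Let A a : {poly F} := expS n.-1 (- r%:R) * toddS F n.-1 ^+ M a *
  invS n.-1 (toddS_at n.-1 r.+1%:R).

Let A_coef0 a : (A a)`_0 = 1.
Proof.
by rewrite !coefM0 coefX0 expS_coef0 // toddS_coef0 // inv_todd_at_coef0 expr1n !mulr1.
Qed.

Let ratioX_coef0 a b : a \in Omega F r -> b != a ->
  (ratioS n.-1 (b / a) ^+ M b)`_0 = 1.
Proof. by move=> aO ba; rewrite coefX0 ratioS_coef0 ?expr1n ?(div_neq1 (Omega_neq0 aO)). Qed.

Let prod_coef0 a : a \in Omega F r ->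
  (\prod_(b in Omega F r | b != a) ratioS n.-1 (b / a) ^+ M b)`_0 = 1.
Proof.
move=> aO; elim/big_rec: _ => [|b f /andP[_ ba] f0]; first by rewrite coef1.
by rewrite coefM0 f0 ratioX_coef0 // mulr1.
Qed.

Lemma Flocal_coef0 a : a \in Omega F r -> (Flocal r M a)`_0 = 1.
Proof. by move=> aO; rewrite take_poly_coef0 coefM0 A_coef0 prod_coef0 // mulr1. Qed.

(** The logarithm turns the product F_a into a sum of table entries. Roots of multiplicity 0
    contribute log 1 = 0, so at most n terms remain. *)
Lemma llocalE a j : a \in Omega F r -> (j < n.-1)%N ->
  llocal r M a j = tab_log1 F n r (M a) j +
    \sum_(b <- supp r M | b != a) tab_log n (b / a) (M b) j.
Proof.
move=> aO jn; have jn' : (j < n.-2.+1)%N by rewrite N12.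
rewrite /llocal /Flocal -/(A a) logS_take //; last first.
  by rewrite coefM0 A_coef0 prod_coef0 // mulr1.
rewrite /tab_log1 -/(A a) logS_take ?A_coef0 //.
have := @logS_mul F n.-2 N2 char2 (A a) _ (A_coef0 a) (prod_coef0 aO) j jn'.
rewrite N12 => ->; congr (_ + _).
rewrite -N12 logS_prod //; last first.
  by move=> b /andP[_ ba]; rewrite N12 ratioX_coef0.
rewrite big_supp; first last.
  move=> b ba ->; rewrite /tab_log logS_take ?expr0 ?coef1 //.
  have := @logS_prod F n.-2 N2 char2 F [::] predT (fun=> 1) (fun _ _ => coef1 F 0) j jn'.
  by rewrite !big_nil N12 => ->.
by apply: eq_bigr => b /andP[_ ba]; rewrite /tab_log logS_take ?N12 ?ratioX_coef0.
Qed.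

Lemma value_eval_local a : a \in Omega F r -> (2 <= M a)%N ->
  value (eval_local r M a) =
    ([seq llocal r M a j | j <- iota 0 (M a).-1],
     [seq flocal r M a j | j <- iota 0 (M a).-1], Clocal r M a).
Proof.
move=> aO M2; rewrite /eval_local 6!value_cbind !value_cmap.
have Man : (M a <= n)%N by rewrite -ltnS.
pose cs := [seq (b / a, M b : nat) | b <- supp r M & b != a].
rewrite -[[seq value (cbind _ _) | b <- _ & _]]/cs.
have -> : [seq value (csum (tab_log1 F n r (M a) j :: [seq tab_log n x.1 x.2 j | x <- cs]))
             | j <- iota 0 (M a).-1] = [seq llocal r M a j | j <- iota 0 (M a).-1].
  apply/eq_in_map => j; rewrite mem_iota add0n => /andP[_ jM].
  rewrite value_csum big_cons -map_comp big_map big_filter llocalE //.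
  by apply: leq_trans jM _; rewrite -!subn1 leq_sub2r.
set l := [seq llocal r M a j | j <- _].
have Ms : ((M a - 2).+1 = (M a).-1)%N by lia.
have -> : value (cexp_coefs l (M a - 2)) = [seq flocal r M a j | j <- iota 0 (M a).-1].
  rewrite (@value_cexp_coefs _ n.-2 _ (Flocal r M a)) ?Ms ?Flocal_coef0 //; first by lia.
  move=> j jM; rewrite (nth_map 0%N) ?size_iota; last by lia.
  by rewrite nth_iota ?add0n ?N12 //; lia.
congr (_, _, _).
rewrite /= value_cprod -map_comp big_map big_filter /Clocal.
congr (_ * _); rewrite big_supp // => b _ M0; rewrite /= M0; exact: expr0.
Qed.

Lemma value_eval_data :
  value (eval_data r M) =
    [seq (a, [seq flocal r M a j | j <- iota 0 (M a).-1], Clocal r M a) | a <- poles r M].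
Proof.
rewrite value_cmap; apply/eq_in_map => a; rewrite mem_filter mem_enum => /andP[M2 aO].
by rewrite value_cbind value_eval_local.
Qed.

Lemma value_eval_hr : value (eval_hr M (value (eval_data r M))) = hM r r M.
Proof.
rewrite value_eval_data /eval_hr value_cbind value_csum value_cmap -map_comp big_map.
rewrite big_poles -[X in hM r X](subn0 r) (@hM_local _ _ _ _ MP _ charF 0) //; last by lia.
apply: eq_bigr => a /andP[aO M2] /=.
rewrite (nth_map 0%N) ?size_iota ?nth_iota; [|by lia..].
by rewrite expS0 // mul1r expr0 divr1.
Qed.

(** Case d = 1 of [hM_local]: the factorials are the coefficients of e^s in the convolution with
    F_a. *)
Lemma value_eval_hr1 : (0 < r)%N -> value (eval_hr1 M (value (eval_data r M))) = hM r r.-1 M.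
Proof.
move=> r0.
rewrite value_eval_data /eval_hr1 value_cbind value_csum value_cmap -map_comp big_map.
rewrite big_poles -subn1 (@hM_local _ _ _ _ MP _ charF 1) //; [|by lia..].
apply: eq_bigr => a /andP[aO M2]; rewrite expr1.
pose f := [seq flocal r M a j | j <- iota 0 (M a).-1].
transitivity (Clocal r M a / a * value (csum (value
  (cmap (fun j => cdiv f`_j (tab_fact F (M a - 2 - j))) (iota 0 (M a).-1))))) => //.
congr (_ * _); rewrite value_csum value_cmap big_map coefMr.
have Ms : (M a).-1 = (M a - 2).+1 by lia.
have Man : (M a <= n)%N by rewrite -ltnS.
rewrite Ms -[iota 0 _]/(index_iota 0 (M a - 2).+1) big_mkord.
apply: eq_bigr => -[j jM] _ /=.
rewrite coef_expS expr1n (_ : (_ < _)%N) ?div1r; last by lia.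
rewrite mulrC /f (nth_map 0%N) ?size_iota; last by lia.
by rewrite nth_iota //; lia.
Qed.

Lemma value_eval_root_prod : value (eval_root_prod r M) = \prod_(a in Omega F r) a ^+ M a.
Proof.
rewrite /eval_root_prod value_cbind value_cprod value_cmap big_map big_suppT /=.
  by apply: eq_bigr => a _; rewrite value_cpow.
by move=> a M0; rewrite value_cpow M0.
Qed.

Theorem value_eval_Theta : value (eval_Theta r M) = (hM r r M, Theta r M).
Proof.
rewrite /eval_Theta 5!value_cbind value_eval_hr.
by rewrite -[value (cmul _ _)]/(_ * _) value_cpow value_eval_root_prod.
Qed.

Theorem value_eval_Theta0 : (0 < r)%N ->
  value (eval_Theta0 r M) = (hM r r M, hM r r.-1 M, Theta0 r M).
Proof.
move=> r0; rewrite /eval_Theta0 7!value_cbind value_eval_hr value_eval_hr1 //.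
rewrite -[value (cmul _ _)]/(_ * _) value_cprod value_cmap big_map value_eval_root_prod.
congr (_, _, (_ * _)); rewrite big_suppT; last first.
  by move=> a M0; rewrite 2!value_cbind value_cpow M0.
by apply: eq_bigr => a _; rewrite 2!value_cbind value_cpow.
Qed.

Lemma sum_supp : (\sum_(a <- supp r M) M a = n)%N.
Proof. by rewrite big_suppT // sum_Msets. Qed.

Lemma size_supp : (size (supp r M) <= n)%N.
Proof.
rewrite -{2}sum_supp -sum1_size !big_seq; apply: leq_sum => a.
by rewrite mem_filter => /andP[].
Qed.

Lemma sum_poles : (\sum_(a <- poles r M) M a <= n)%N.
Proof.
rewrite big_poles big_mkcondr /=.
apply: (@leq_trans (\sum_(a in Omega F r) M a)); last by rewrite (sum_Msets MP).
by apply: leq_sum => a _; case: ifP.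
Qed.

Lemma size_poles : (2 * size (poles r M) <= n)%N.
Proof.
apply: leq_trans sum_poles; rewrite mulnC -sum1_size big_distrl /= !big_seq.
by apply: leq_sum => a; rewrite mem_filter mul1n => /andP[].
Qed.

(** The bound is proportional to mu_a rather than to n: since the mu_a sum to at most n over the
    poles, the total stays quadratic instead of cubic. *)
Lemma cost_eval_local a : (2 <= M a)%N -> (cost (eval_local r M a) <= 6 * n * M a)%N.
Proof.
move=> M2; rewrite /eval_local 6!cost_cbind.
set s := [seq b <- supp r M | b != a].
have sn : (size s <= n)%N by rewrite size_filter (leq_trans (count_size _ _)) ?size_supp.
have Man : (M a <= n)%N by rewrite -ltnS.
have -> : cost (cmap (fun b => let! c := cdiv b a in cret (c, M b : nat)) s) = size s.
  by rewrite cost_cmap -[RHS]sum1_size; apply: eq_bigr => b _.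
rewrite cost_cprod size_map value_cmap size_map.
set t := cmap (fun j => csum _) _.
have -> : cost t = ((M a).-1 * (size s).+1)%N.
  rewrite cost_cmap; under eq_bigr do rewrite cost_csum /= !size_map.
  by rewrite big_const_seq count_predT size_iota iter_addn_0 mulnC.
set l := value t; have := cost_cexp_coefs l (M a - 2).
set c := cost _; have -> : ((M a - 2).+1 = (M a).-1)%N by lia.
rewrite /= addn0; move: (size s) sn (nat_of_ord (M a)) M2 Man c => S sn [|k] // _ kn c /= cl.
have kS : (k * S <= k * n)%N by rewrite leq_mul2l sn orbT.
have kk : (k ^ 2 <= k * n)%N by rewrite -mulnn leq_mul2l (ltnW kn) orbT.
have k1 : (k <= k * n)%N by rewrite leq_pmulr // (leq_trans _ kn).
by move: cl kS kk k1; rewrite !mulnS -!mulnA [(n * k)%N]mulnC; lia.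
Qed.

Lemma cost_eval_data : (cost (eval_data r M) <= 6 * n ^ 2)%N.
Proof.
rewrite /eval_data cost_cmap -mulnn mulnA.
apply: leq_trans (leq_mul (leqnn (6 * n)) sum_poles).
rewrite big_distrr /= !big_seq; apply: leq_sum => a.
rewrite mem_filter => /andP[M2 _].
by rewrite -[X in (X <= _)%N]/(cost (eval_local r M a) + 0)%N addn0 cost_eval_local.
Qed.

Lemma cost_eval_hr : cost (eval_hr M (value (eval_data r M))) = (2 * size (poles r M))%N.
Proof.
rewrite value_eval_data /eval_hr cost_cbind cost_csum value_cmap cost_cmap.
rewrite big_map !size_map mul2n -addnn; congr (_ + _)%N.
by rewrite -[RHS]sum1_size; apply: eq_bigr => a _.
Qed.

(** A pole a costs mu_a - 1 divisions, as many additions, and two operations for C_a / a and the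
    product: 2 mu_a in all, hence a linear total. *)
Lemma cost_eval_hr1 : (cost (eval_hr1 M (value (eval_data r M))) <= 3 * n)%N.
Proof.
rewrite value_eval_data /eval_hr1 cost_cbind cost_csum value_cmap cost_cmap.
rewrite big_map !size_map.
have sp := sum_poles; have := size_poles.
set t := (\sum_(a <- _) _)%N; have -> : t = (\sum_(a <- poles r M) (2 * (M a).-1 + 2))%N.
  apply: eq_bigr => a _; pose f := [seq flocal r M a j | j <- iota 0 (M a).-1].
  pose g := cmap (fun j => cdiv f`_j (tab_fact F (M a - 2 - j))) (iota 0 (M a).-1).
  transitivity (cost g + (cost (csum (value g)) + (1 + 1)))%N => //.
  rewrite cost_csum value_cmap size_map size_iota cost_cmap sum1_size size_iota.
  by rewrite addnA addnn mul2n.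
have -> : (\sum_(a <- poles r M) (2 * (M a).-1 + 2) = 2 * \sum_(a <- poles r M) M a)%N.
  rewrite big_distrr /= big_seq [RHS]big_seq; apply: eq_bigr => a.
  by rewrite mem_filter => /andP[M2 _]; rewrite -mulnSr prednK // ltnW.
by lia.
Qed.

Lemma cost_eval_root_prod : (cost (eval_root_prod r M) <= 2 * n)%N.
Proof.
rewrite /eval_root_prod cost_cbind cost_cprod value_cmap size_map cost_cmap.
under eq_bigr do rewrite cost_cpow.
by rewrite sum_supp mul2n -addnn leq_add2l size_supp.
Qed.

Let common_cost := (cost (eval_data r M) + cost (eval_hr M (value (eval_data r M))) +
  cost (eval_root_prod r M))%N.

Lemma cost_eval_ThetaE : cost (eval_Theta r M) = (common_cost + n.+1)%N.
Proof.
pose data := value (eval_data r M).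
transitivity (cost (eval_data r M) + (cost (eval_hr M data) + (cost (eval_root_prod r M) +
  (cost (cpow (value (eval_hr M data)) n) + (1 + 0)))))%N; first by [].
rewrite cost_cpow /common_cost -/data; move: (cost _) (cost _) (cost _) => x y z; lia.
Qed.

Lemma cost_eval_Theta0E : cost (eval_Theta0 r M) =
  (common_cost + cost (eval_hr1 M (value (eval_data r M))) + (3 * size (supp r M) + n.+1))%N.
Proof.
pose data := value (eval_data r M).
pose t := cmap (fun a => let! w := cmul a (value (eval_hr1 M data)) in
  let! x := csub (value (eval_hr M data)) w in cpow x (M a)) (supp r M).
transitivity (cost (eval_data r M) + (cost (eval_hr M data) + (cost (eval_hr1 M data) +
  (cost (eval_root_prod r M) + (cost t + (cost (cprod (value t)) + (1 + 0)))))))%N.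
  by [].
rewrite cost_cprod value_cmap size_map.
have -> : cost t = (\sum_(a <- supp r M) (2 + M a))%N.
  rewrite cost_cmap; apply: eq_bigr => a _.
  rewrite -[in RHS](cost_cpow (value (eval_hr M data) - a * value (eval_hr1 M data)) (M a)).
  by [].
have -> : (\sum_(a <- supp r M) (2 + M a) = 2 * size (supp r M) + n)%N.
  by rewrite big_split /= big_const_seq count_predT iter_addn_0 sum_supp.
rewrite /common_cost -/data.
move: (size (supp r M)) (cost _) (cost _) (cost _) (cost _) => S x y z u; lia.
Qed.

Lemma common_cost_le : (common_cost <= 6 * n ^ 2 + 3 * n)%N.
Proof.
rewrite /common_cost cost_eval_hr.
by have := cost_eval_data; have := cost_eval_root_prod; have := size_poles; lia.
Qed.

Lemma cost_eval_Theta_le : (cost (eval_Theta r M) <= 18 * n ^ 2)%N.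
Proof. by rewrite cost_eval_ThetaE; have := common_cost_le; nia. Qed.

Lemma cost_eval_Theta0_le : (cost (eval_Theta0 r M) <= 18 * n ^ 2)%N.
Proof.
rewrite cost_eval_Theta0E; have := common_cost_le; have := cost_eval_hr1.
by have := size_supp; nia.
Qed.

(** The excess of [eval_Theta0] is [eval_hr1] and three operations per distinct root, at most 6 n in
    all, while the power h_r(M)^n alone already costs n. *)
Lemma cost_eval_Theta0_Theta : (cost (eval_Theta0 r M) <= 18 * cost (eval_Theta r M))%N.
Proof.
rewrite cost_eval_Theta0E cost_eval_ThetaE.
by have := cost_eval_hr1; have := size_supp; lia.
Qed.

Lemma cost_eval_Theta_Theta0 : (cost (eval_Theta r M) <= 18 * cost (eval_Theta0 r M))%N.
Proof. by rewrite cost_eval_Theta0E cost_eval_ThetaE; lia. Qed.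

End Evaluation.

(** * Counting matrices by roots of unity *)

Section RootsOfUnity.
Variables (F : finFieldType) (r : nat) (z : F).
Hypothesis z_prim : r.+1.-primitive_root z.

Lemma big_Omega (R : Type) (idx : R) (op : Monoid.com_law idx) (f : F -> R) :
  \big[op/idx]_(a in Omega F r) f a = \big[op/idx]_(i < r.+1) f (z ^+ i).
Proof.
have -> : Omega F r = [set z ^+ (i : 'I_r.+1) | i in setT].
  apply/setP => a; rewrite inE; apply/eqP/imsetP => [/(prim_rootP z_prim)[i ->]|[i _ ->]].
    by exists i.
  by rewrite exprAC (prim_expr_order z_prim) expr1n.
rewrite big_imset /=; first by apply: eq_bigl => i; rewrite inE.
move=> i j _ _ /eqP; rewrite (eq_prim_root_expr z_prim) !modn_small ?ltn_ord //.
by move/eqP/val_inj.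
Qed.

Lemma card_Omega : #|Omega F r| = r.+1.
Proof. by rewrite -sum1_card big_Omega sum1_card card_ord. Qed.

Lemma sum_Omega k : \sum_(a in Omega F r) a ^+ k = if (r.+1 %| k)%N then r.+1%:R else 0.
Proof.
rewrite big_Omega; under eq_bigr do rewrite exprAC.
have zk : (z ^+ k == 1) = (r.+1 %| k)%N by rewrite (prim_order_dvd z_prim).
case: ifP => dk.
  rewrite -zk in dk; rewrite (eqP dk); under eq_bigr do rewrite expr1n.
  by rewrite sumr_const card_ord.
apply/eqP; move/negbT: dk; rewrite -zk -subr_eq0 => /negbTE z1.
rewrite -(mulrI_eq0 _ (mulfI (negbT z1))) -subrX1 exprAC (prim_expr_order z_prim).
by rewrite expr1n subrr.
Qed.
End RootsOfUnity.

(** The multinomial count, by induction on the first letter x: what follows is a permutation of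
    [rem x s], and removing one x divides the product of factorials by [count_mem x s]. *)
Lemma size_permutations_count (T : finType) (s : seq T) :
  (size (permutations s) * \prod_a (count_mem a s)`! = (size s)`!)%N.
Proof.
have [k] := ubnP (size s); elim: k s => // k IH s sk.
have [/size0nil->|s0'] := posnP (size s); first by rewrite big1 ?muln1.
rewrite (perm_size (permutationsE s0')) size_allpairs_dep sumnE big_map big_distrl /=.
have rec x : x \in undup s ->
    (size (permutations (rem x s)) * \prod_a (count_mem a s)`! =
     count_mem x s * (size s).-1`!)%N.
  rewrite mem_undup => xs.
  have -> : (\prod_a (count_mem a s)`! = count_mem x s * \prod_a (count_mem a (rem x s))`!)%N.
    rewrite (bigD1 x) //= [in RHS](bigD1 x) //= mulnA.
    congr (_ * _)%N; last first.
      apply: eq_bigr => a ax; rewrite count_rem xs /= [x == a]eq_sym (negbTE ax).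
      by rewrite subn0.
    rewrite count_rem xs /= eqxx subn1.
    have : (0 < count_mem x s)%N by rewrite -has_count has_pred1.
    by case: (count_mem x s) => // c _; rewrite factS.
  rewrite mulnCA IH ?size_rem //.
  by rewrite -ltnS (leq_trans _ sk) // ltnS; case: (size s) s0'.
rewrite big_seq (eq_bigr _ rec) -big_seq -big_distrl /=.
have -> : (\sum_(x <- undup s) count_mem x s = size s)%N.
  rewrite -sum1_size -(big_undup_iterop_count _ s predT (fun=> 1%N)).
  by apply: eq_bigr => x _; rewrite Monoid.iteropE iter_addn_0 mul1n.
by rewrite -[in RHS](prednK s0') factS prednK.
Qed.

Lemma card_codom_perm (F : finType) (x0 : F) n (s : seq F) : size s = n ->
  #|[set x : {ffun 'I_n -> F} | perm_eq (codom x) s]| = size (permutations s).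
Proof.
move=> sn.
pose g (t : seq F) : {ffun 'I_n -> F} := [ffun i : 'I_n => nth x0 t i].
have gK t : t \in permutations s -> codom (g t) = t.
  rewrite mem_permutations => /perm_size; rewrite sn => st.
  apply: (@eq_from_nth _ x0); first by rewrite size_codom card_ord.
  move=> i; rewrite size_codom card_ord => ilt.
  by rewrite (nth_map (Ordinal ilt)) ?size_enum_ord // ffunE nth_enum_ord.
rewrite -(size_map g); apply/esym; have /card_uniqP <- : uniq (map g (permutations s)).
  rewrite map_inj_in_uniq ?permutations_uniq // => t t' tP tP' e.
  by rewrite -(gK t tP) -(gK t' tP') e.
apply: eq_card => x; rewrite inE; apply/mapP/idP => [[t tP ->]|xs].
  by rewrite gK // -mem_permutations.
exists (codom x); first by rewrite mem_permutations.
apply/ffunP => i; rewrite ffunE (nth_map i) ?size_enum_ord //.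
by rewrite nth_ord_enum.
Qed.

Definition zero_diag_row n r (i : 'I_n) (f : {ffun 'I_n -> 'I_r.+1}) : bool :=
  ((f i : nat) == 0%N) && ((\sum_j (f j : nat))%N == r).

Lemma sum_zero_diag_row (F : fieldType) n r (x : 'I_n -> F) i : (0 < r)%N ->
  \sum_(f : {ffun 'I_n -> 'I_r.+1} | zero_diag_row i f) \prod_j x j ^+ f j =
  hseq r (codom x) - x i * hseq r.-1 (codom x).
Proof.
case: r => // r _; set xs := [seq x j | j <- enum 'I_n & j != i].
have perm_x : perm_eq (codom x) (x i :: xs).
  rewrite -[x i :: xs]/(map x (i :: [seq j <- enum 'I_n | j != i])); apply: perm_map.
  apply: uniq_perm => [||j]; first exact: enum_uniq.
    by rewrite cons_uniq mem_filter eqxx filter_uniq // enum_uniq.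
  by rewrite in_cons [LHS]mem_enum [in RHS]mem_filter mem_enum andbT; case: eqP.
(* By [hseqS] the right-hand side is h_r of the variables other than x_i. *)
rewrite !(hseq_perm _ perm_x) hseqS /= addrK.
pose Q (j : 'I_n) (k : 'I_r.+2) := (j == i) ==> ((k : nat) == 0%N).
transitivity (\prod_j \sum_(k < r.+2 | Q j k) (x j ^+ k) *: 'X^k)`_r.+1.
  rewrite hseqE; apply: eq_bigl => f; congr (_ && _).
  apply/idP/forallP => [f0 j|/(_ i)]; last by rewrite /Q eqxx.
  by apply/implyP => /eqP ->.
rewrite /hseq big_map big_filter big_enum_cond /=; congr ((_ : {poly F})`_ _).
rewrite (bigD1 i) //= (big_pred1 ord0) => [|k]; last by rewrite /Q eqxx.
rewrite expr0 scale1r mul1r; apply: eq_bigr => j ji.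
by rewrite /geomS poly_def; apply: eq_bigl => k; rewrite /Q (negbTE ji).
Qed.

Lemma colsums_eq n r (A : 'I_n -> 'I_n -> nat) :
  (forall i, \sum_j A i j = r)%N ->
  [forall j, (r.+1 %| (\sum_i A i j).+1)%N] = [forall j, (\sum_i A i j)%N == r].
Proof.
move=> row; apply/forallP/forallP => [dv j|col j]; last by rewrite (eqP (col j)).
have le k : (r <= \sum_i A i k)%N by rewrite -ltnS dvdn_leq.
(* The equality case of the summed bounds [le]: both totals equal n r once the summations are
   exchanged. *)
have := @leqif_sum _ predT _ _ _ (fun k _ => leqif_eq (le k)).
case=> _; rewrite exchange_big /= (eq_bigr _ (fun i _ => row i)) eqxx.
by move/esym/forallP/(_ j)/eqP => {1}->.
Qed.

Section RootsOfUnityFilter.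
Variables (F : finFieldType) (n r : nat) (z : F).
Hypothesis z_prim : r.+1.-primitive_root z.

(* The sum over x selects the matrices with all column sums congruent to -1
   modulo m, hence at least r; as the row sums are r, the column sums are r. *)
Lemma Dcount_roots_of_unity :
  \sum_(x : {ffun 'I_n -> F} | x \in ffun_on (mem (Omega F r))) (\prod_i x i *
    \prod_i \sum_(f : {ffun 'I_n -> 'I_r.+1} | zero_diag_row i f) \prod_j x j ^+ f j) =
  r.+1%:R ^+ n * (Dcount n r)%:R.
Proof.
pose ffm := {ffun 'I_n -> {ffun 'I_n -> 'I_r.+1}}.
pose rows (A : ffm) := [forall i, zero_diag_row i (A i)].
pose cols (A : ffm) := [forall j, (\sum_i (A i j : nat))%N == r].
transitivity (\sum_(A : ffm | rows A)
    \sum_(x : {ffun 'I_n -> F} | x \in ffun_on (mem (Omega F r)))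
    \prod_j x j ^+ (\sum_i (A i j : nat)).+1).
  rewrite exchange_big; apply: eq_bigr => x _.
  rewrite bigA_distr_big_dep big_distrr /=; apply: eq_big => [A|A _].
    by apply/familyP/forallP => h i; have := h i; rewrite unfold_in.
  rewrite exchange_big -big_split; apply: eq_bigr => j _ /=.
  by rewrite exprS prodrXr.
transitivity (\sum_(A : ffm | rows A && cols A) r.+1%:R ^+ n : F).
  rewrite big_mkcondr; apply: eq_bigr => A rA.
  rewrite -(bigA_distr_big (mem (Omega F r))
    (fun (j : 'I_n) (a : F) => a ^+ (\sum_i (A i j : nat)).+1)).
  under eq_bigr do rewrite (sum_Omega z_prim).
  rewrite /cols -colsums_eq => [|i]; last by have /forallP/(_ i)/andP[_ /eqP] := rA.
  case: forallP => [dv|/forallP].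
    by under eq_bigr do rewrite dv; rewrite prodr_const card_ord.
  rewrite negb_forall => /existsP[j /negbTE jr].
  by rewrite (bigD1 j) //= jr mul0r.
rewrite sumr_const -[LHS]mulr_natr; congr (_ * _%:R).
pose h (A : ffm) : 'M['I_r.+1]_n := \matrix_(i, j) A i j.
have h_inj : injective h.
  by move=> A B /matrixP e; apply/ffunP => i; apply/ffunP => j; have := e i j; rewrite !mxE.
rewrite /Dcount -(card_imset _ h_inj); apply: eq_card => B; rewrite inE.
apply/imsetP/and3P => [[A /andP[/forallP rA /forallP cA] ->]|].
  split; apply/forallP => i.
  - by rewrite mxE; have /andP[] := rA i.
  - by under eq_bigr do rewrite mxE; have /andP[] := rA i.
  - by under eq_bigr do rewrite mxE; apply: cA.
move=> [/forallP dB /forallP rB /forallP cB].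
exists [ffun i => [ffun j => B i j]]; last by apply/matrixP => i j; rewrite mxE !ffunE.
apply/andP; split; apply/forallP => i.
  rewrite /zero_diag_row !ffunE dB /=; under eq_bigr do rewrite !ffunE; exact: rB.
by under eq_bigr do rewrite !ffunE; apply: cB.
Qed.

End RootsOfUnityFilter.

(** Theta_0 for a tuple, before grouping by multiset, so that permuted and dilated tuples can be
    compared directly. *)
Definition theta0_seq (F : fieldType) r (xs : seq F) : F :=
  \prod_(x <- xs) x * \prod_(x <- xs) (hseq r xs - x * hseq r.-1 xs).

Lemma theta0_seq_perm (F : fieldType) r (xs ys : seq F) :
  perm_eq xs ys -> theta0_seq r xs = theta0_seq r ys.
Proof.
by move=> e; rewrite /theta0_seq !(hseq_perm _ e) !(perm_big _ e).
Qed.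

Lemma hseq_scale (F : fieldType) j k (xs : seq F) :
  hseq j [seq k * x | x <- xs] = k ^+ j * hseq j xs.
Proof.
rewrite /hseq big_map -coef_comp_scaleX; congr ((_ : {poly F})`_ _).
rewrite (big_morph (fun p : {poly F} => p \Po (k *: 'X))
  (fun p q => comp_polyM p q _) (comp_polyC _ _)).
apply: eq_bigr => x _; apply/polyP => i; rewrite coef_comp_scaleX !coef_poly.
by case: ifP => _; rewrite ?mulr0 // exprMn.
Qed.

(** Both h_r and x h_(r-1) scale by k^r, and the monomial in front brings one more k per entry: k^m
    = 1 for each entry. *)
Lemma theta0_seq_scale (F : fieldType) r k (xs : seq F) : (0 < r)%N -> k ^+ r.+1 = 1 ->
  theta0_seq r [seq k * x | x <- xs] = theta0_seq r xs.
Proof.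
case: r => // r _ k1; rewrite /theta0_seq !hseq_scale !big_map big_split /=.
have -> : \prod_(x <- xs) (k ^+ r.+1 * hseq r.+1 xs - k * x * (k ^+ r * hseq r xs)) =
  \prod_(x <- xs) k ^+ r.+1 * \prod_(x <- xs) (hseq r.+1 xs - x * hseq r xs).
  rewrite -big_split; apply: eq_bigr => x _ /=.
  by rewrite exprS; ring.
have e : \prod_(x <- xs) k * \prod_(x <- xs) k ^+ r.+1 = 1.
  by rewrite -big_split big1 //= => x _; rewrite -exprS.
by rewrite mulrACA e mul1r.
Qed.

(** * From tuples to multisets, and dilation of multisets *)

Section Grouping.
Variables (F : finFieldType) (n r : nat).
Implicit Types (M : {ffun F -> 'I_n.+1}) (a c : F).

Lemma Theta0_seq M : M \in Msets F n r -> Theta0 r M = theta0_seq r (entries r M).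
Proof. by move=> MP; rewrite /Theta0 /theta0_seq !prod_entries // !hM_hseq. Qed.

(** In particular the truncating division in [multM] is exact. *)
Lemma multM_permutations M : M \in Msets F n r ->
  multM r M = size (permutations (entries r M)).
Proof.
move=> MP; have := size_permutations_count (entries r M); rewrite size_entries //.
have -> : (\prod_a (count_mem a (entries r M))`! = \prod_(a in Omega F r) (M a)`!)%N.
  rewrite [RHS]big_mkcond; apply: eq_bigr => a _; rewrite count_entries //.
  by case: ifPn => // /(Msets_notin MP) ->.
rewrite /multM => <-; rewrite mulnK // prodn_gt0 // => a; exact: fact_gt0.
Qed.

Lemma sum_count_mem (A : {set F}) (s : seq F) : all (mem A) s ->
  (\sum_(a in A) count_mem a s = size s)%N.
Proof.
elim: s => [|y s IH] /=; first by rewrite big1.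
move=> /andP[yA sA]; rewrite big_split /= IH // (bigD1 y) //= eqxx big1 // => a.
by rewrite eq_sym => /andP[_ /negbTE ->].
Qed.

Definition multiset_of (x : {ffun 'I_n -> F}) : {ffun F -> 'I_n.+1} :=
  [ffun a => inord (count_mem a (codom x))].

Lemma multiset_ofE x a : multiset_of x a = count_mem a (codom x) :> nat.
Proof.
rewrite ffunE inordK // ltnS (leq_trans (count_size _ _)) //.
by rewrite size_codom card_ord.
Qed.

Lemma ffun_on_codom (x : {ffun 'I_n -> F}) :
  (x \in ffun_on (mem (Omega F r))) = all (mem (Omega F r)) (codom x).
Proof.
apply/ffun_onP/allP => [xO _ /codomP[i ->]|xO i]; first exact: xO.
exact/xO/codom_f.
Qed.

Lemma multiset_of_Msets x : x \in ffun_on (mem (Omega F r)) -> multiset_of x \in Msets F n r.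
Proof.
rewrite ffun_on_codom => /allP xO; rewrite inE; apply/andP; split.
  apply/forallP => a; apply/implyP => aO; rewrite multiset_ofE.
  by rewrite -leqn0 leqNgt -has_count has_pred1; apply: contra aO => /xO.
under eq_bigr do rewrite multiset_ofE.
by rewrite sum_count_mem ?size_codom ?card_ord //; apply/allP.
Qed.

Lemma multiset_of_perm (x : {ffun 'I_n -> F}) M : M \in Msets F n r ->
  (x \in ffun_on (mem (Omega F r))) && (multiset_of x == M) =
  perm_eq (codom x) (entries r M).
Proof.
move=> MP; apply/andP/idP => [[xO /eqP e]|xM].
  by apply/allP => a _ /=; rewrite count_entries // -e multiset_ofE.
split.
  rewrite ffun_on_codom; apply/allP => a; rewrite (perm_mem xM); apply: contraLR.
  exact: entries_notin.
apply/eqP/ffunP => a; apply: val_inj; rewrite /= multiset_ofE.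
by rewrite (seq.permP xM) count_entries.
Qed.

Lemma sum_theta0_seq :
  \sum_(x : {ffun 'I_n -> F} | x \in ffun_on (mem (Omega F r))) theta0_seq r (codom x) =
  \sum_(M in Msets F n r) (multM r M)%:R * Theta0 r M.
Proof.
rewrite (partition_big multiset_of (mem (Msets F n r))) /=; last exact: multiset_of_Msets.
apply: eq_bigr => M MP; rewrite (eq_bigl _ _ (fun x => multiset_of_perm x MP)).
rewrite (eq_bigr (fun=> Theta0 r M)) => [|x xM]; last first.
  by rewrite Theta0_seq //; apply: theta0_seq_perm.
rewrite sumr_const -[LHS]mulr_natl multM_permutations //.
rewrite -(card_codom_perm 0 (size_entries MP)); congr (_%:R * _).
by apply: eq_card => x; rewrite inE.
Qed.

(** These bounds make eta(M) invertible in F. Each most frequent root has multiplicity at least 1,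
    and the multiplicities sum to n. *)
Lemma eta_bounds M : (0 < n)%N -> M \in Msets F n r -> (0 < eta r M <= n)%N.
Proof.
move=> n0 MP; have sM := sum_Msets MP.
have [a aO aq] : {a | a \in Omega F r & qmax r M = M a}.
  apply: eq_bigmax_cond; rewrite card_gt0; apply/set0Pn; exists 1.
  by rewrite inE expr1n.
have q0 : (0 < qmax r M)%N.
  rewrite lt0n; apply: contraTneq n0 => q0; rewrite -leqNgt -[leqLHS]sM.
  rewrite big1 // => b bO; apply/eqP; rewrite -leqn0 -q0.
  exact: (@leq_bigmax_cond _ (mem (Omega F r)) (fun b => M b : nat)).
rewrite /eta; apply/andP; split.
  by rewrite card_gt0; apply/set0Pn; exists a; rewrite inE aO aq eqxx.
apply: (@leq_trans (\sum_(b in Omega F r) M b)); last by rewrite sM.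
rewrite -sum1_card big_mkcond [leqRHS]big_mkcond; apply: leq_sum => b _.
by rewrite inE; case: (b \in Omega F r) => //=; case: eqP => // ->.
Qed.

(** The multiset of the x / c for x in M. *)
Definition dilate c M : {ffun F -> 'I_n.+1} := [ffun a => M (c * a)].

Lemma big_Omega_dilate (R : Type) (idx : R) (op : Monoid.com_law idx) c
    (P : pred F) (f : F -> R) : c \in Omega F r ->
  \big[op/idx]_(a in Omega F r | P (c * a)) f (c * a) =
  \big[op/idx]_(a in Omega F r | P a) f a.
Proof.
move=> cO; rewrite [RHS](reindex_inj (mulfI (Omega_neq0 cO))).
by apply: eq_bigl => a; move: cO; rewrite !inE exprMn => /eqP ->; rewrite mul1r.
Qed.

Lemma big_Omega_dilateT (R : Type) (idx : R) (op : Monoid.com_law idx) c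
    (f : F -> R) : c \in Omega F r ->
  \big[op/idx]_(a in Omega F r) f (c * a) = \big[op/idx]_(a in Omega F r) f a.
Proof.
by move=> cO; have := @big_Omega_dilate _ _ op c predT f cO; rewrite !big_mkcondr.
Qed.

Section Dilate.
Variables (c : F) (M : {ffun F -> 'I_n.+1}).
Hypotheses (cO : c \in Omega F r) (MP : M \in Msets F n r).

Lemma dilate_Msets : dilate c M \in Msets F n r.
Proof.
rewrite inE; apply/andP; split.
  apply/forallP => a; apply/implyP => aO; rewrite ffunE (Msets_notin MP) //.
  by apply: contra aO; move: cO; rewrite !inE exprMn => /eqP ->; rewrite mul1r.
under eq_bigr do rewrite ffunE.
by rewrite (big_Omega_dilateT _ (fun a => M a : nat)) // sum_Msets.
Qed.

Lemma qmax_dilate : qmax r (dilate c M) = qmax r M.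
Proof.
rewrite /qmax; under eq_bigr do rewrite ffunE.
exact: (big_Omega_dilateT _ (fun a => M a : nat)).
Qed.

Lemma eta_dilate : eta r (dilate c M) = eta r M.
Proof.
rewrite /eta qmax_dilate -!sum1_card.
under eq_bigl do rewrite inE ffunE.
under [RHS]eq_bigl do rewrite inE.
exact: (big_Omega_dilate _ (fun a => (M a : nat) == qmax r M) (fun=> 1%N)).
Qed.

Lemma multM_dilate : multM r (dilate c M) = multM r M.
Proof.
rewrite /multM; under eq_bigr do rewrite ffunE.
by rewrite (big_Omega_dilateT _ (fun a => (M a)`!)).
Qed.

(** Multiplying the entries of [dilate c M] by c gives those of M up to order, and
    [theta0_seq_scale] applies because c^m = 1. *)
Lemma Theta0_dilate : (0 < r)%N -> Theta0 r (dilate c M) = Theta0 r M.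
Proof.
move=> r0; rewrite !Theta0_seq ?dilate_Msets //.
have c0 := Omega_neq0 cO.
rewrite -(@theta0_seq_scale _ _ c (entries r (dilate c M))) //; last first.
  by move: cO; rewrite inE => /eqP.
apply: theta0_seq_perm; apply/allP => a _ /=.
rewrite count_map (count_entries MP) -[a](mulVKf c0).
rewrite (eq_count (a2 := pred1 (c^-1 * a))) => [|b /=].
  by rewrite (count_entries dilate_Msets) ffunE.
by rewrite (inj_eq (mulfI c0)).
Qed.
End Dilate.
End Grouping.

(** * The counting formula *)

Section Count.
Variables (F : finFieldType) (n r : nat) (z : F).
Hypotheses (n_gt2 : (2 < n)%N) (r_gt0 : (0 < r)%N) (z_prim : r.+1.-primitive_root z).
Hypotheses (charF : natr_unit F n) (m_neq0 : r.+1%:R != 0 :> F).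

Lemma Dcount_sum_Theta0 :
  r.+1%:R ^+ n * (Dcount n r)%:R =
  \sum_(M in Msets F n r) (multM r M)%:R * Theta0 r M :> F.
Proof.
rewrite -sum_theta0_seq -(Dcount_roots_of_unity n z_prim); apply: eq_bigr => x _.
rewrite /theta0_seq !big_image /=; congr (_ * _); apply: eq_bigr => i _.
exact: sum_zero_diag_row.
Qed.

(* Each multiset is counted once for each of its eta(M) most frequent roots a,
   and the dilation by a^-1 moves a to 1. *)
Lemma sum_Theta0_dilate :
  \sum_(M in Msets F n r) (multM r M)%:R * Theta0 r M =
  r.+1%:R * \sum_(M in Msets F n r | (M 1 : nat) == qmax r M)
    (multM r M)%:R / (eta r M)%:R * Theta0 r M.
Proof.
transitivity (\sum_(M in Msets F n r) \sum_(a in Omega F r | (M a : nat) == qmax r M)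
   (multM r M)%:R / (eta r M)%:R * Theta0 r M).
  apply: eq_bigr => M MP.
  have -> : \sum_(a in Omega F r | (M a : nat) == qmax r M)
     (multM r M)%:R / (eta r M)%:R * Theta0 r M =
     (multM r M)%:R / (eta r M)%:R * Theta0 r M *+ eta r M.
    rewrite (eq_bigl (mem [set a in Omega F r | (M a : nat) == qmax r M])) => [|a].
      by rewrite sumr_const.
    by rewrite [RHS]in_set.
  have eta0 : (eta r M)%:R != 0 :> F by apply/charF/eta_bounds; rewrite // ltnW // ltnW.
  by rewrite -[RHS]mulr_natr; field.
rewrite (exchange_big_dep (mem (Omega F r))) /=; last by move=> M a _ /andP[].
rewrite mulr_natl -(card_Omega z_prim) -sumr_const; apply: eq_bigr => a aO.
have a0 := Omega_neq0 aO; have aVO : a^-1 \in Omega F r.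
  by move: aO; rewrite !inE exprVn => /eqP ->; rewrite invr1.
rewrite (reindex_onto (dilate a^-1) (dilate a)) /=; last first.
  by move=> M _; apply/ffunP => b; rewrite !ffunE mulVKf.
apply: eq_big => M.
  have -> : dilate a (dilate a^-1 M) == M by apply/eqP/ffunP => b; rewrite !ffunE mulKf.
  rewrite aO andbT /= ffunE mulVf //.
  have -> : (dilate a^-1 M \in Msets F n r) = (M \in Msets F n r).
    apply/idP/idP => MP; last exact: (dilate_Msets aVO MP).
    have := dilate_Msets aO MP; rewrite (_ : dilate a _ = M) //.
    by apply/ffunP => b; rewrite !ffunE mulKf.
  by case: (boolP (M \in _)) => // MP; rewrite (qmax_dilate M aVO).
move=> /andP[/andP[MP _] /eqP dM]; have MP' : M \in Msets F n r.
  by rewrite -dM (dilate_Msets aO).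
by rewrite (multM_dilate M aVO) (eta_dilate M aVO) (Theta0_dilate aVO).
Qed.

Lemma Theta0_eq0 (M : {ffun F -> 'I_n.+1}) :
  M \in Msets F n r -> (qmax r M < 2)%N -> Theta0 r M = 0.
Proof.
(* The cases d = 0 and d = 1 are h_r and h_(r-1); both are sums over an empty set of poles. *)
move=> MP q2; have h0 d : (d <= 1)%N -> hseq (r - d) (entries r M) = 0.
  move=> d1; rewrite -hM_hseq // (hM_local MP) //; try lia.
  apply: big_pred0 => a; apply/negbTE/negP => /andP[aO]; rewrite leqNgt => /negP; apply.
  apply: leq_ltn_trans q2.
  exact: (@leq_bigmax_cond _ (mem (Omega F r)) (fun b => M b : nat)).
rewrite Theta0_seq // /theta0_seq -[r in hseq r _]subn0 -subn1 !h0 //.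
have := size_entries MP; case: (entries r M) => [/= /esym n0|x xs _].
  by exfalso; move: n_gt2; rewrite n0.
by rewrite [X in _ * X]big_cons mulr0 subrr mul0r mulr0.
Qed.

Theorem Dcount_formula :
  (Dcount n r)%:R = (r.+1%:R : F) ^ (1 - n%:Z) *
    \sum_(M in Mmax F n r) (multM r M)%:R / (eta r M)%:R * Theta0 r M.
Proof.
have -> : \sum_(M in Mmax F n r) (multM r M)%:R / (eta r M)%:R * Theta0 r M =
    \sum_(M in Msets F n r | (M 1 : nat) == qmax r M)
      (multM r M)%:R / (eta r M)%:R * Theta0 r M.
  rewrite [RHS](bigID (fun M => 2 <= qmax r M)%N) /= [X in _ = _ + X]big1 ?addr0.
    by apply: eq_bigl => M; rewrite inE andbA.
  by move=> M /andP[/andP[MP _]]; rewrite -ltnNge => /(Theta0_eq0 MP) ->; rewrite mulr0.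
(* In m^(1-n) = m * m^(-n), the factor m turns the sum over [M 1 = qmax M] into the sum over all
   multisets, and that sum is m^n D_n(r). *)
rewrite expfzDr // expr1z -exprnN mulrAC -sum_Theta0_dilate -Dcount_sum_Theta0.
by rewrite mulrAC divff ?mul1r // expf_neq0.
Qed.
End Count.

Lemma natr_unit_Fp p n : prime p -> (n < p)%N -> natr_unit 'F_p n.
Proof.
move=> p_pr np k /andP[k0 kn]; rewrite -(dvdn_pcharf (pchar_Fp p_pr)).
by rewrite gtnNdvd // (leq_ltn_trans kn).
Qed.

Lemma prim_root_finField (F : finFieldType) m : (0 < m)%N -> (m %| #|F|.-1)%N ->
  exists z : F, m.-primitive_root z.
Proof.
move=> m0 mF; have F1 := finNzRing_gt1 F; have F0 : (0 < #|F|)%N := ltnW F1.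
have /hasP[x _ xp] : has #|F|.-1.-primitive_root [seq x : F <- enum F | x != 0].
  apply: has_prim_root; rewrite ?filter_uniq ?enum_uniq //; first by rewrite -ltnS prednK.
    apply/allP => x; rewrite mem_filter => /andP[x0 _]; rewrite unity_rootE.
    by rewrite -(inj_eq (mulfI x0)) -exprS prednK // expf_card mulr1.
    by rewrite -enumT enum_uniq.
  by rewrite -(cardC1 (0 : F)) cardE {1}/enum_mem -enumT.
exists (x ^+ (#|F|.-1 %/ m)); exact: dvdn_prim_root.
Qed.

Theorem proposition4p1 :
  (forall (n r p : nat),
     (3 <= n)%N -> (1 <= r)%N -> prime p -> (n < p)%N -> (r.+1 %| p.-1)%N ->
     (Dcount n r)%:R =
       (r.+1%:R : 'F_p) ^ (1 - n%:Z) *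
       \sum_(M in Mmax 'F_p n r)
          (multM r M)%:R / (eta r M)%:R * Theta0 r M)
  /\
  (exists K : nat, forall (n r p : nat),
     (3 <= n)%N -> (1 <= r)%N -> prime p -> (n < p)%N -> (r.+1 %| p.-1)%N ->
     forall M : {ffun 'F_p -> 'I_n.+1}, M \in Msets 'F_p n r ->
       (* the local evaluations compute what they should *)
       [/\ forall a : 'F_p, a \in Omega 'F_p r -> (2 <= M a)%N ->
             value (eval_local r M a) =
               ([seq llocal r M a j | j <- iota 0 (M a).-1],
                [seq flocal r M a j | j <- iota 0 (M a).-1],
                Clocal r M a),
           value (eval_Theta r M) = (hM r r M, Theta r M)
         & value (eval_Theta0 r M) = (hM r r M, hM r r.-1 M, Theta0 r M)]
       /\
       (* both cost O(n^2), and each costs O of the other *)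
       [/\ (cost (eval_Theta r M) <= K * n ^ 2)%N,
           (cost (eval_Theta0 r M) <= K * n ^ 2)%N,
           (cost (eval_Theta0 r M) <= K * cost (eval_Theta r M))%N
         & (cost (eval_Theta r M) <= K * cost (eval_Theta0 r M))%N]).
Proof.
split=> [n r p n3 r1 p_pr np rp|].
  have [|z z_prim] := @prim_root_finField 'F_p r.+1 (ltn0Sn r); first by rewrite card_Fp.
  apply: (Dcount_formula n3 r1 z_prim (natr_unit_Fp p_pr np)).
  have p1 := prime_gt1 p_pr.
  (* As m divides p - 1, it is smaller than p and so nonzero in F_p. *)
  have rp' : (r.+1 <= p.-1)%N by apply: dvdn_leq rp; lia.
  by apply: (@natr_unit_Fp p r.+1 p_pr) => //; lia.
(* Both costs are at most 6 n^2 + 10 n + 1, which is below 18 n^2; the same constant serves the two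
   comparisons. *)
exists 18 => n r p n3 r1 p_pr np rp M MP; have charF := natr_unit_Fp p_pr np.
split; split.
- by move=> a aO M2; apply: (value_eval_local MP n3 charF aO M2).
- exact: (value_eval_Theta MP n3 charF).
- exact: (value_eval_Theta0 MP n3 charF r1).
- exact: (cost_eval_Theta_le MP n3 charF).
- exact: (cost_eval_Theta0_le MP n3 charF).
- exact: (cost_eval_Theta0_Theta MP n3 charF).
- exact: cost_eval_Theta_Theta0.
Qed.
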